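(* For integers $1\le k<n$ let $X_{n,k}$ be the number of subtrees of size $k$ in the random binary search tree $\mathcal{T}_n$, and let $\hat X_{n,k}$ be the number of subtrees of size $k$ in the random recursive tree $\Lambda_n$. Let $k=k_n$ with $k<n$, and put $\mu_{n,k}:=\mathbb{E}(X_{n,k})$ and $\hat\mu_{n,k}:=\mathbb{E}(\hat X_{n,k})$. Then $$\mu_{n,k}=\frac{2(n+1)}{(k+1)(k+2)},\qquad \hat\mu_{n,k}=\frac{n}{k(k+1)}.$$ Moreover, for the binary search tree, $$d_{TV}\bigl(\mathcal{L}(X_{n,k}),\mathrm{Po}(\mu_{n,k})\bigr)=\frac12\sum_{l\ge 0}\Bigl|\mathbb{P}(X_{n,k}=l)-e^{-\mu_{n,k}}\frac{(\mu_{n,k})^l}{l!}\Bigr|=O\Bigl(\frac1k\Bigr),$$ and for the random recursive tree, $$d_{TV}\bigl(\mathcal{L}(\hat X_{n,k}),\mathrm{Po}(\hat\mu_{n,k})\bigr)=\frac12\sum_{l\ge 0}\Bigl|\mathbb{P}(\hat X_{n,k}=l)-e^{-\hat\mu_{n,k}}\frac{(\hat\mu_{n,k})^l}{l!}\Bigr|=O\Bigl(\frac1k\Bigr).$$ Consequently, if $n\to\infty$ and $k\to\infty$, then $d_{TV}(\mathcal{L}(X_{n,k}),\mathrm{Po}(\mu_{n,k}))\to0$ and $d_{TV}(\mathcal{L}(\hat X_{n,k}),\mathrm{Po}(\hat\mu_{n,k}))\to0$.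
   Context: Random binary search tree $\mathcal{T}_n$: insert the keys of a uniformly random permutation of $\{1,\dots,n\}$ one by one; the first key is placed at the root, and each later key starts at the root and at each occupied node proceeds to the left child position if it is smaller than the key there and to the right child position if it is larger, until it reaches an empty position, where it is placed. Random recursive tree $\Lambda_n$: start with a root labelled $1$; for $i=2,\dots,n$, node $i$ is attached as a child of a uniformly random node among $1,\dots,i-1$ (independently of earlier choices). The size of a tree is its number of nodes. A subtree always means a fringe subtree: a node together with all its descendants; a subtree is counted once for each node at which such a fringe subtree is rooted. $\mathcal{L}(X)$ is the distribution of $X$, $\mathrm{Po}(\mu)$ the Poisson distribution with mean $\mu$, and the total variation distance is $d_{TV}(\mu_1,\mu_2):=\sup_A|\mu_1(A)-\mu_2(A)|$ over measurable sets $A$. The constants implied by $O$ are absolute (uniform in $n$ and $k$ with $1\le k<n$). *)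

(* Defs.v *)
From HB Require Import structures.
From mathcomp Require Import all_boot all_order all_algebra all_fingroup finmap.
From mathcomp Require Import all_classical all_reals all_analysis.

Set Implicit Arguments.
Unset Strict Implicit.
Unset Printing Implicit Defensive.

Import Order.TTheory GRing.Theory Num.Theory.
Import numFieldNormedType.Exports.

Inductive bintree := Empty | Node of bintree & nat & bintree.

Fixpoint bst_insert (x : nat) (t : bintree) : bintree :=
  match t with
  | Empty => Node Empty x Empty
  | Node l y r => if x < y then Node (bst_insert x l) y r
                  else Node l y (bst_insert x r)
  end.

Fixpoint bintree_size (t : bintree) : nat :=
  match t with
  | Empty => 0
  | Node l _ r => (bintree_size l + bintree_size r).+1
  end.

(* Counts nodes: the empty tree has no fringe subtree, not even for k = 0. *)
Fixpoint bintree_subtrees (k : nat) (t : bintree) : nat :=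
  match t with
  | Empty => 0
  | Node l _ r => (bintree_size t == k) + bintree_subtrees k l
                  + bintree_subtrees k r
  end.

(* 'S_n permutes {0, .., n-1}; the i-th key (i = 0, .., n-1) is s i + 1. *)
Definition bst_of_perm (n : nat) (s : 'S_n) : bintree :=
  foldl (fun t x => bst_insert x t) Empty [seq (s i).+1 | i <- enum 'I_n].

(* A recursive tree on the labels 1, .., n is given by p, where p i is the
   parent of i for 1 < i <= n (the other values of p are irrelevant).
   The label of u : 'I_n is u + 1. *)
Definition rectree_child (n : nat) (p : nat -> nat) : rel 'I_n :=
  fun u v => (1 < u.+1) && (p u.+1 == v.+1).

Definition rectree_subtree (n : nat) (p : nat -> nat) (v : 'I_n) : pred 'I_n :=
  fun u => connect (rectree_child p) u v.

Definition rectree_subtrees (k n : nat) (p : nat -> nat) : nat :=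
  #|[pred v : 'I_n | #|rectree_subtree p v| == k]|.

Local Open Scope classical_set_scope.
Local Open Scope ring_scope.
Local Open Scope ereal_scope.

Definition uniform_permutation (R : realType) (d : measure_display)
    (T : measurableType d) (P : probability T R) (n : nat)
    (sigma : T -> 'S_n) : Prop :=
  forall s : 'S_n, measurable (sigma @^-1` [set s]) /\
    P (sigma @^-1` [set s]) = ((n`!%:R)^-1)%:E.

Definition mutually_independent (R : realType) (d : measure_display)
    (T : measurableType d) (P : probability T R) (I : choiceType)
    (D : set I) (X : I -> {RV P >-> nat}) : Prop :=
  forall J : {fset I}, [set` J] `<=` D ->
  forall A : I -> set nat, (forall i, measurable (A i)) ->
    P (\bigcap_(i in [set` J]) (X i @^-1` A i)) =
    \prod_(i <- J) P (X i @^-1` A i).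

(* par i is the random parent of the node i, for 1 < i <= n. *)
Definition random_recursive_parents (R : realType) (d : measure_display)
    (T : measurableType d) (P : probability T R) (n : nat)
    (par : nat -> {RV P >-> nat}) : Prop :=
  (forall i j : nat, (1 < i <= n)%N -> (1 <= j < i)%N ->
     P (par i @^-1` [set j]) = ((i.-1%:R)^-1)%:E) /\
  mutually_independent [set i : nat | (1 < i <= n)%N] par.

Definition bst_subtrees (T : Type) (n : nat) (sigma : T -> 'S_n) (k : nat) :
    T -> nat :=
  fun w => bintree_subtrees k (bst_of_perm (sigma w)).

Definition rrt_subtrees (R : realType) (d : measure_display)
    (T : measurableType d) (P : probability T R) (n : nat)
    (par : nat -> {RV P >-> nat}) (k : nat) : T -> nat :=
  fun w => rectree_subtrees k n (fun i => par i w).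

Definition expect_nat (R : realType) (d : measure_display)
    (T : measurableType d) (P : probability T R) (X : T -> nat) : \bar R :=
  'E_P[fun w => (X w)%:R].

Definition dTV (R : realType) (d : measure_display) (T : measurableType d)
    (mu nu : set T -> \bar R) : \bar R :=
  ereal_sup [set `|mu A - nu A| | A in (measurable : set (set T))].

(* The total variation distance between L(X) and Po(E X).
   The last argument of the library's poisson_prob is a dummy. *)
Definition dTV_poisson (R : realType) (d : measure_display)
    (T : measurableType d) (P : probability T R) (X : T -> nat) : \bar R :=
  dTV (pushforward P X) (poisson_prob (fine (expect_nat P X)) 0).

Definition half_l1_poisson (R : realType) (d : measure_display)
    (T : measurableType d) (P : probability T R) (X : T -> nat) : \bar R :=
  let mu := fine (expect_nat P X) in
  (2^-1)%:E * \sum_(0 <= l <oo)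
    `| P (X @^-1` [set l]) - (expR (- mu) * mu ^+ l / l`!%:R)%:E |.

(* Main.v *)
Require Import Defs.
From HB Require Import structures.
From mathcomp Require Import all_boot all_order all_algebra all_fingroup finmap.
From mathcomp Require Import all_classical all_reals all_analysis.
From mathcomp Require Import measurable_realfun.
From mathcomp Require Import ring lra zify.

Set Implicit Arguments.
Unset Strict Implicit.
Unset Printing Implicit Defensive.

Import Order.TTheory GRing.Theory Num.Theory.
Import numFieldNormedType.Exports.

(** Both counts are statistics of one random binary tree.  Start with a single
    leaf and repeatedly replace a uniformly chosen leaf by a node with two
    leaves.  The tree with m nodes has the shape of a random binary search tree
    with m keys.  Read with labelled leaves, the same growth is that of a random
    recursive tree with m + 1 nodes: splitting the leaf j into j and a new label
    attaches the new label to j, and the fringe subtrees that do not contain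
    the root are the right children.  So the two counts are the numbers of
    children with K leaves, K = k + 1 and both children counted in the first
    case, K = k and only right children counted in the second.

    The size of the left child of the root is uniform ([sum_shapes_split]), so
    the probability generating functions phi_m of the count in a tree with
    m nodes satisfy, with beta equal to 2 or 1,
      (m + 1) phi_(m+1) = sum_(i <= m) phi_i phi_(m-i)
                          + beta ('X - 1) phi_(m+1-K) + (one correction),
    the correction occurring only when both children of the root can have K
    leaves ([fringe_recursion]).  No further information on the trees is used.

    Differentiating at 1 gives the mean c (m + 1), c = beta / (K (K + 1)).  The
    polynomial D_m = phi_m^`() - c (m + 1) phi_m is Stein's operator in terms of
    generating functions.  As the mean is linear in m + 1, the D_m satisfy the
    linearised recursion, with sources that come from the indices below K and
    from the tolls ([mean_defectS]).  For m >= K they vanish at 1,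
    so that D_m = psi_m ('X - 1), and the recursion for psi_m contains, apart
    from small terms, only differences phi_i - phi_j.  The l1 norms of these differences,
      divided by
    'X - 1, are Wasserstein distances, and their sum over consecutive indices
    below m is at most 22 (m + 1) / K^2 ([W_bound]).  An induction then yields
    norm1 psi_m <= 826 (m + 1) / K^3, except for an additional 3 / K at the one
    index of the correction ([mean_quotient_bound]).

    Let g solve the Stein equation for the Poisson law of mean lam and a set A.
    Pairing D_m with g gives the difference of the probabilities of A up to
    sign, while summation by parts pairs psi_m with the increments of g, which
    are bounded by 1 and by 1 / lam ([stein_sol_smooth]).  With
    lam = c (m + 1), of order (m + 1) / K^2, the difference is O(1 / K).

    A law given by a polynomial exceeds the Poisson weights only on a finite set
    of integers.  The total variation distance is attained on this set, and it
    is half of the l1 distance because the differences of the weights sum to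
    0. *)

Local Open Scope classical_set_scope.
Local Open Scope ring_scope.

(** * The l1 norm on polynomials *)

Section norm1.
Variable R : realFieldType.
Implicit Types p q : {poly R}.

(** The total mass of the signed measure with generating function [p]. *)
Definition norm1 p : R := \sum_(i < size p) `|p`_i|.

Lemma norm1E n p : (size p <= n)%N -> norm1 p = \sum_(i < n) `|p`_i|.
Proof.
move=> le_pn; rewrite /norm1 (big_ord_widen n (fun i => `|p`_i|) le_pn).
rewrite [RHS](bigID (fun i : 'I_n => (i < size p)%N)) /=.
rewrite [X in _ = _ + X]big1 ?addr0 // => i.
by rewrite -leqNgt => lepi; rewrite nth_default ?normr0.
Qed.

Lemma norm1_ge0 p : 0 <= norm1 p.
Proof. by apply: sumr_ge0 => i _. Qed.

Lemma norm1D p q : norm1 (p + q) <= norm1 p + norm1 q.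
Proof.
pose n := maxn (size p) (size q).
rewrite (@norm1E n p) ?leq_maxl // (@norm1E n q) ?leq_maxr //.
rewrite (@norm1E n) ?size_polyD // -big_split /=.
by apply: ler_sum => i _; rewrite coefD ler_normD.
Qed.

Lemma norm1_sum I (r : seq I) (P : pred I) (F : I -> {poly R}) :
  norm1 (\sum_(i <- r | P i) F i) <= \sum_(i <- r | P i) norm1 (F i).
Proof.
elim/big_rec2: _ => [|i y p _ IH]; first by rewrite /norm1 size_poly0 big_ord0.
by apply: le_trans (norm1D _ _) _; rewrite lerD2l.
Qed.

Lemma norm1Z c p : norm1 (c *: p) = `|c| * norm1 p.
Proof.
rewrite (@norm1E (size p)) ?size_scale_leq // /norm1 mulr_sumr.
by apply: eq_bigr => i _; rewrite coefZ normrM.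
Qed.

Lemma norm1N p : norm1 (- p) = norm1 p.
Proof.
by rewrite /norm1 size_polyN; apply: eq_bigr => i _; rewrite coefN normrN.
Qed.

Lemma norm1XnM n p : norm1 ('X^n * p) = norm1 p.
Proof.
have [->|p0] := eqVneq p 0; first by rewrite mulr0.
rewrite (@norm1E (n + size p)); last by rewrite -commr_polyXn size_mulXn.
rewrite big_split_ord /= big1 ?add0r; last first.
  by move=> i _; rewrite coefXnM ltn_ord normr0.
by apply: eq_bigr => i _; rewrite coefXnM ltnNge leq_addr /= addKn.
Qed.

Lemma norm1M p q : norm1 (p * q) <= norm1 p * norm1 q.
Proof.
rewrite -[p in p * q]coefK poly_def mulr_suml.
apply: le_trans (norm1_sum _ _ _) _; rewrite {2}/norm1 mulr_suml.
by apply: ler_sum => i _; rewrite -scalerAl norm1Z norm1XnM.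
Qed.

Lemma norm1C c : norm1 c%:P = `|c|.
Proof.
rewrite (@norm1E 1) ?size_polyC ?leq_b1 //.
by rewrite big_ord_recl big_ord0 addr0 coefC.
Qed.

Lemma norm1CM c p : norm1 (c%:P * p) = `|c| * norm1 p.
Proof. by rewrite mul_polyC norm1Z. Qed.

Lemma norm1natM n p : norm1 (n%:R * p) = n%:R * norm1 p.
Proof. by rewrite -[n%:R in LHS]polyC_natr norm1CM normr_nat. Qed.

Lemma norm1Xn n : norm1 'X^n = 1.
Proof. by rewrite -[X in norm1 X]mulr1 norm1XnM norm1C normr1. Qed.

Lemma norm1x1 p : norm1 (('X - 1) * p) <= 2 * norm1 p.
Proof.
apply: le_trans (norm1M _ _) _; rewrite ler_wpM2r ?norm1_ge0 //.
apply: le_trans (norm1D _ _) _.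
by rewrite norm1N -[X in norm1 X]expr1 norm1Xn norm1C normr1.
Qed.

End norm1.

(** * The recursion of a random split *)

Section recursion.
Variables (R : realFieldType) (K : nat) (beta gamma : R).
Variable phi : nat -> {poly R}.
Let x1 : {poly R} := 'X - 1.

(** The recursion of the generating functions of a count on binary trees whose
    root splits uniformly.  The second term accounts for a child of the root
    with [K] leaves: such a child is itself counted, hence 'X = 1 + ('X - 1),
    and the count inside it is 0.  The last term is the cross term of two
    such children. *)
Definition split_recursion := forall m : nat,
  m.+1%:R * phi m.+1 = \sum_(i < m.+1) phi i * phi (m - i)
    + (if (K <= m.+1)%N then beta%:P * ('X - 1) * phi (m.+1 - K) else 0)
    + (if m.+1 == K.*2.-1 then gamma%:P * ('X - 1) ^+ 2 else 0).

Hypothesis K_gt0 : (0 < K)%N.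
Hypothesis beta_ge1 : 1 <= beta.
Hypothesis beta_le2 : beta <= 2.
Hypothesis gamma_ge0 : 0 <= gamma.
Hypothesis gamma_le1 : gamma <= 1.
Hypothesis phi0 : phi 0 = 1.
Hypothesis phi_at1 : forall m, (phi m).[1] = 1.
Hypothesis norm1_phi : forall m, norm1 (phi m) <= 1.
Hypothesis phiS : split_recursion.

Lemma beta_ge0 : 0 <= beta. Proof. exact: le_trans ler01 beta_ge1. Qed.

Lemma natr_poly_neq0 n : (n.+1%:R : {poly R}) != 0.
Proof. by rewrite -polyC_natr polyC_eq0 pnatr_eq0. Qed.

Lemma x1_neq0 : x1 != 0.
Proof. by rewrite /x1 -polyC1 polyXsubC_eq0. Qed.

Lemma phi_small m : (m < K)%N -> phi m = 1.
Proof.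
elim/ltn_ind: m => -[|m] IH mK //.
apply: (mulfI (natr_poly_neq0 m)); rewrite phiS leqNgt mK /=.
rewrite ifN; last by apply/eqP; lia.
rewrite !addr0 mulr1 (eq_bigr (fun=> 1)) ?sumr_const ?card_ord //.
by move=> i _; rewrite !IH ?mulr1 //; have := ltn_ord i; lia.
Qed.

(** The coefficients of [delta n] are, up to sign, the differences of the
    distribution functions of the laws [phi n] and [phi n.+1], so that
    [norm1 (delta n)] is their Wasserstein distance. *)
Definition delta n := (phi n.+1 - phi n) %/ x1.

Lemma deltaE n : phi n.+1 = phi n + delta n * x1.
Proof.
rewrite /delta divpK; first by rewrite addrC subrK.
rewrite /x1 dvdp_XsubCl; apply/rootP.
by rewrite hornerD hornerN !phi_at1 subrr.
Qed.

Lemma delta_small n : (n.+1 < K)%N -> delta n = 0.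
Proof.
by move=> nK; rewrite /delta !phi_small ?subrr ?div0p // ltnW.
Qed.

Lemma delta_K : (1 < K)%N -> delta K.-1 = (beta / K%:R)%:P.
Proof.
move=> K2.
have K0 : (K%:R : R) != 0 by rewrite pnatr_eq0; lia.
have KE : K.-1.+1 = K by lia.
apply: (mulIf x1_neq0); apply: (mulfI (natr_poly_neq0 K.-1)).
have := phiS K.-1; rewrite deltaE KE leqnn subnn phi0 mulr1 ifN; last by lia.
rewrite (phi_small (m := K.-1)); last by lia.
rewrite (eq_bigr (fun=> 1)); last first.
  by move=> i _; rewrite !phi_small ?mulr1 //; have := ltn_ord i; lia.
rewrite sumr_const card_ord mulrDr mulr1 -/x1 addr0 => /addrI ->.
by rewrite -polyC_natr !mulrA -polyCM mulrCA divff // mulr1.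
Qed.

(** The two indices at which the cross term enters the recursion of [delta].
    There [norm1 (delta n)] may be of order 1 / K, and not 1 / K^2. *)
Definition spike n := (n.+1 == K.*2.-1) || (n == K.*2.-1).

(** Subtract the recursions at two consecutive indices and cancel 'X - 1.  In
    the quadratic sum one factor of each product is replaced by its increment;
    the product left over is [phi p.+1 * phi 0], and it compensates the change
    of the coefficient on the left. *)
Lemma deltaS p : (K <= p.+1)%N ->
  p.+2%:R * delta p.+1 = \sum_(i < p.+1) delta i * phi (p - i)
    + beta%:P * (x1 * delta (p.+1 - K))
    + ((if p.+2 == K.*2.-1 then gamma%:P * x1 else 0)
       - (if p.+1 == K.*2.-1 then gamma%:P * x1 else 0)).
Proof.
move=> Kp; apply: (mulIf x1_neq0).
have E2 := phiS p.+1; have E1 := phiS p.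
rewrite leqW // in E2; rewrite Kp in E1.
rewrite big_ord_recr /= subnn phi0 mulr1 in E2.
rewrite (deltaE p.+1) mulrDr subSn // (deltaE (p.+1 - K)) in E2.
have S2 : \sum_(i < p.+1) phi i * phi (p.+1 - i) =
    \sum_(i < p.+1) phi i * phi (p - i)
    + (\sum_(i < p.+1) delta i * phi (p - i)) * x1.
  rewrite [X in _ = _ + X * _](reindex_inj rev_ord_inj) /=.
  rewrite mulr_suml -big_split /=; apply: eq_bigr => i _.
  have ip := ltn_ord i; rewrite subSn; last by lia.
  rewrite deltaE subSS (_ : (p - (p - i))%N = i); last by lia.
  by ring.
rewrite S2 in E2.
have -> : p.+2%:R * delta p.+1 * x1 = p.+2%:R * (delta p.+1 * x1) by ring.
apply: (addrI (p.+2%:R * phi p.+1)); rewrite E2.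
have -> : p.+2%:R * phi p.+1 = p.+1%:R * phi p.+1 + phi p.+1.
  by rewrite -[p.+2]addn1 natrD; ring.
rewrite E1.
rewrite -!/x1 !expr2; case: ifP => _; case: ifP => _; ring.
Qed.

Let w n := norm1 (delta n).
Let W n := \sum_(i < n) w i.

Lemma w_ge0 n : 0 <= w n. Proof. exact: norm1_ge0. Qed.

Lemma w_step p : (K <= p.+1)%N ->
  p.+2%:R * w p.+1 <= W p.+1 + 4 * w (p.+1 - K) + 2 * (spike p.+1)%:R.
Proof.
move=> Kp; rewrite /w -norm1natM deltaS //.
apply: le_trans (norm1D _ _) _; apply: lerD.
  apply: le_trans (norm1D _ _) _; apply: lerD.
    apply: le_trans (norm1_sum _ _ _) _; apply: ler_sum => i _.
    apply: le_trans (norm1M _ _) _.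
    by rewrite -[leRHS]mulr1 ler_wpM2l ?norm1_ge0.
  rewrite norm1CM ger0_norm ?beta_ge0 //.
  have := beta_le2; have := beta_ge0; have := norm1x1 (delta (p.+1 - K));
    have := norm1_ge0 (delta (p.+1 - K)).
  by rewrite -/x1; nra.
have Gx : norm1 (gamma%:P * x1) <= 2.
  rewrite norm1CM ger0_norm //.
  have := gamma_le1; have := norm1x1 (1 : {poly R}); rewrite norm1C normr1 mulr1 -/x1.
  by have := norm1_ge0 x1; nra.
rewrite /spike; case: eqP => [E|_]; case: eqP => [F|_] /=.
- by move: E F; lia.
- by rewrite subr0 mulr1.
- by rewrite sub0r norm1N mulr1.
- by rewrite subrr norm1C normr0 mulr0.
Qed.

Lemma W_small n : (n < K)%N -> W n = 0.
Proof.
move=> nK; apply: big1 => i _; rewrite /w delta_small ?norm1C ?normr0 //.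
by have := ltn_ord i; lia.
Qed.

Lemma w_K : (1 < K)%N -> w K.-1 <= 2 / K%:R.
Proof.
move=> K2.
have K0 : 0 < (K%:R : R) by rewrite ltr0n; lia.
by rewrite /w delta_K // norm1C ger0_norm ?divr_ge0 ?beta_ge0 // ler_pM2r ?invr_gt0.
Qed.

(** By [w_step], [w n] is an average of the earlier increments up to two
    sources.  The first K - 1 increments vanish, which lowers the average
    by enough to absorb the sources. *)
Lemma w_bound n : (48 <= K)%N -> K%:R * w n <= 4.
Proof.
move=> K48; have K48R : 48 <= (K%:R : R) by rewrite (ler_nat _ 48).
elim/ltn_ind: n => n IH.
have [nK|Kn] := ltnP n.+1 K.
  by rewrite /w delta_small // norm1C normr0 mulr0.
have [nK|Kn'] := eqVneq n K.-1.
  by rewrite nK; have := w_K ltac:(lia); rewrite ler_pdivlMr //; lra.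
have {Kn Kn'} : (K <= n)%N by lia.
case: n IH => [|p] IH Kp; first by lia.
have WB m : (m <= p.+1)%N -> K%:R * W m <= 4 * (m.+1 - K)%:R.
  elim: m => [|m IHm] mp; first by rewrite /W big_ord0 mulr0 mulr_ge0.
  have [mK|Km] := ltnP m.+1 K; first by rewrite W_small // mulr0 mulr_ge0.
  rewrite /W big_ord_recr /= -/(W m) (_ : (m.+2 - K = (m.+1 - K).+1)%N); last by lia.
  by rewrite -(natr1 (m.+1 - K)) !mulrDr mulr1 lerD ?IHm ?IH //; lia.
have := WB p.+1 (leqnn _); rewrite natrB; last by lia.
have := w_step Kp; have := IH (p.+1 - K)%N ltac:(lia).
have : (spike p.+1)%:R <= 1 :> R by case: spike.
rewrite -[p.+2%:R]natr1; set s : R := (spike _)%:R.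
have := w_ge0 p.+1; have := w_ge0 (p.+1 - K); have : 0 <= p.+1%:R :> R by [].
move: (w (p.+1 - K)) (w p.+1) (W _) (p.+1%:R) (K%:R : R) K48R => a b c x k.
move=> ????? H1 H2 H3.
have x1p : 0 < x + 1 by lra.
rewrite -(ler_pM2l x1p).
have : (x + 1) * b * k <= (c + 4 * a + 2 * s) * k by rewrite ler_pM2r //; lra.
by nra.
Qed.

Let E n := ((K.*2.-2 < n) + (K.*2.-1 < n))%N.

Lemma spikeE n : (spike n + E n)%N = E n.+1.
Proof. by rewrite /spike /E; case: eqP; case: eqP => /=; lia. Qed.

Lemma spike_large n : (spike n)%:R * K%:R ^+ 2 <= (spike n)%:R * (n.+1%:R * n.+2%:R) :> R.
Proof.
rewrite /spike; case: (boolP (_ || _)) => [h|_] /=; last by rewrite !mul0r.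
by rewrite !mul1r expr2 -!natrM ler_nat leq_mul //; case/orP: h => /eqP; lia.
Qed.

(** By [w_step], [W n / n.+1] grows by at most
    (16 / K + 2 [spike n]) / ((n + 1) (n + 2)).  The first part telescopes and
    is the term 16 K; the second occurs for two values of n only, which are at
    least K. *)
Lemma W_bound_sharp n : (48 <= K)%N -> (K <= n)%N ->
  K%:R ^+ 2 * W n <= n.+1%:R * (18 + 2 * (E n)%:R) - 16 * K%:R.
Proof.
move=> K48; have K48R : 48 <= (K%:R : R) by rewrite (ler_nat _ 48).
elim: n => [|n IH] Kn; first by lia.
have := Kn; rewrite leq_eqVlt => /orP[/eqP Kn1|Kn1].
  rewrite /W big_ord_recr /= -/(W n) W_small ?add0r; last by lia.
  have -> : n = K.-1 by lia.
  have := w_K ltac:(lia); rewrite ler_pdivlMr; last by lra.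
  rewrite prednK; last by lia.
  rewrite -[K.+1%:R]natr1; have : 0 <= (E K)%:R :> R by [].
  move: (w K.-1) ((E K)%:R : R) (K%:R : R) K48R => a e k.
  by nra.
have := IH Kn1; have := w_bound (n - K) K48; have := spike_large n.
case: n Kn1 {IH Kn} => [|p] Kp; first by lia.
have -> : W p.+2 = W p.+1 + w p.+1 by rewrite /W big_ord_recr.
rewrite -(spikeE p.+1) natrD; have := w_step Kp; have : 0 <= (E p.+1)%:R :> R by [].
have : 0 <= (spike p.+1)%:R :> R by [].
rewrite -[p.+3%:R]natr1; have : 0 < p.+2%:R :> R by rewrite ltr0n.
move: (E p.+1)%:R (spike p.+1)%:R (w (p.+1 - K)) (w p.+1) (W _) (p.+2%:R) (K%:R : R) K48R
  => e s a b c x k.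
move=> kge xgt s0 e0 H1 H2 H3 H4.
rewrite -(ler_pM2l xgt).
have P1 : k ^+ 2 * (x * b) <= k ^+ 2 * (c + 4 * a + 2 * s) by rewrite ler_wpM2l ?sqr_ge0.
have P2 : (x + 1) * (k ^+ 2 * c) <= (x + 1) * (x * (18 + 2 * e) - 16 * k).
  by rewrite ler_wpM2l //; lra.
have P3 : k * (k * a) <= k * 4 by rewrite ler_wpM2l //; lra.
by nra.
Qed.

Lemma W_bound n : (48 <= K)%N -> K%:R ^+ 2 * W n <= 22 * n.+1%:R.
Proof.
move=> K48; have [nK|Kn] := ltnP n K; first by rewrite W_small // mulr0 mulr_ge0.
apply: le_trans (W_bound_sharp K48 Kn) _.
have : (E n)%:R <= 2 :> R by rewrite (ler_nat _ _ 2) /E; do 2 case: (_ < _)%N.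
have : 0 <= n.+1%:R :> R by []. have : 0 <= K%:R :> R by [].
by move: (E n)%:R n.+1%:R K%:R => e x k; nra.
Qed.

Let c : R := beta / (K%:R * K.+1%:R).

(** Pairing the coefficients of [mean_defect m] with a function g gives
    E[X g(X - 1)] - lam E[g(X)] for X of law [phi m] and lam = c (m + 1), which
    is Stein's operator for the Poisson law of mean lam. *)
Definition mean_defect m := (phi m)^`() - (c * m.+1%:R)%:P * phi m.
Local Notation D := mean_defect.

Lemma KcE : c * K%:R * K.+1%:R = beta.
Proof. by rewrite /c -mulrA divfK // mulf_neq0 // pnatr_eq0; lia. Qed.

Lemma c_ge0 : 0 <= c.
Proof. by rewrite /c divr_ge0 ?beta_ge0 ?mulr_ge0. Qed.

(** Differentiate the recursion.  Since (i + 1) + (m - i + 1) = m + 2, a mean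
    that is linear in m + 1 is consistent with the quadratic sum, and the terms
    recombine into defects.  Only the tolls leave a source. *)
Lemma mean_defectS m :
  m.+1%:R * D m.+1 = 2 * \sum_(i < m.+1) D i * phi (m - i)
   + (if (K <= m.+1)%N then beta%:P * (x1 * D (m.+1 - K)
           + phi (m.+1 - K) * (1 - (c * K%:R)%:P * x1)) else 0)
   + (if m.+1 == K.*2.-1 then gamma%:P * (2 * x1 - (c * m.+2%:R)%:P * x1 ^+ 2) else 0).
Proof.
have dx1 : x1^`() = 1 by rewrite /x1 derivB derivX derivC subr0.
have dS : m.+1%:R * (phi m.+1)^`() = 2 * (\sum_(i < m.+1) (phi i)^`() * phi (m - i))
   + (if (K <= m.+1)%N then beta%:P * (phi (m.+1 - K) + x1 * (phi (m.+1 - K))^`()) else 0)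
   + (if m.+1 == K.*2.-1 then gamma%:P * (2 * x1) else 0).
  have := congr1 (@deriv _) (phiS m); rewrite -polyC_natr mul_polyC derivZ -mul_polyC
    polyC_natr => ->.
  rewrite !derivD raddf_sum; congr (_ + _ + _).
  - rewrite (eq_bigr (fun i : 'I_m.+1 => (phi i)^`() * phi (m - i) + phi i
    * (phi (m - i))^`())); last first.
      by move=> i _ /=; rewrite derivM.
    rewrite big_split /= [X in _ + X](reindex_inj rev_ord_inj) /=.
    rewrite mulr_natl mulr2n; congr (_ + _); apply: eq_bigr => i _.
    have im := ltn_ord i; rewrite subSS mulrC (_ : (m - (m - i))%N = i) //; lia.
  - case: ifP => _; last by rewrite derivC.
    by rewrite -mulrA mul_polyC derivZ derivM dx1 mul1r -mul_polyC.
  - case: ifP => _; last by rewrite derivC.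
    by rewrite mul_polyC derivZ expr2 derivM -/x1 dx1 -mul_polyC mulr1 mul1r mulr_natl
      mulr2n.
(* Reversing the order of summation exchanges i.+1 and (m - i).+1. *)
have sym : 2 * (\sum_(i < m.+1) (c * i.+1%:R)%:P * (phi i * phi (m - i))) =
   (c * m.+2%:R)%:P * (\sum_(i < m.+1) phi i * phi (m - i)).
  rewrite mulr_natl mulr2n [X in X + _](reindex_inj rev_ord_inj) /= -big_split mulr_sumr.
  apply: eq_bigr => i _ /=; have im := ltn_ord i; rewrite subSS (_ : (m - (m - i))%N = i);
    last by lia.
  rewrite [phi (m - i) * _]mulrC -mulrDl -polyCD -mulrDr -natrD; congr (_%:P * _);
    congr (_ * _%:R); lia.
rewrite /D mulrBr dS.
rewrite [X in _ = 2 * X + _ + _](eq_bigr (fun i : 'I_m.+1 => (phi i)^`() * phi (m - i) -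
    (c * i.+1%:R)%:P * (phi i * phi (m - i)))); last first.
  by move=> i _; rewrite mulrBl mulrA.
rewrite sumrB [2 * (\sum_(i < _) _ - _)]mulrBr sym [m.+1%:R * (_ * _)]mulrCA phiS -/x1.
case: ifP => Km; last by case: ifP => _; ring.
have -> : (c * m.+2%:R)%:P = (c * (m.+1 - K).+1%:R)%:P + (c * K%:R)%:P :> {poly R}.
  by rewrite -polyCD -mulrDr -natrD; congr (_ * _%:R)%:P; lia.
by case: ifP => _; ring.
Qed.

(** This identity determines [c]: at 1, the defects of the indices below [K]
    cancel the toll. *)
Lemma sum_c : \sum_(i < K) 2 * (c * i.+1%:R) = beta.
Proof.
rewrite -KcE; elim: (K) => [|n IH]; first by rewrite big_ord0 mulr0 mul0r.
by rewrite big_ord_recr /= IH -[n.+2%:R]natr1 -[n.+1%:R]natr1; ring.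
Qed.

Lemma mean_defect_small m : (m < K)%N -> D m = - (c * m.+1%:R)%:P.
Proof. by move=> mK; rewrite /D phi_small // derivC sub0r mulr1. Qed.

Lemma mean_defect_at1 m : (K <= m)%N -> (D m).[1] = 0.
Proof.
elim/ltn_ind: m => -[|m] IH Km; first by lia.
have x11 : x1.[1] = 0 by rewrite /x1 !hornerE subrr.
have := congr1 (horner^~ 1) (mean_defectS m); rewrite /= Km 2!hornerD.
have -> : (if m.+1 == K.*2.-1 then gamma%:P * (2 * x1 - (c * m.+2%:R)%:P * x1 ^+ 2)
    else 0).[1] = 0.
  case: ifP => _; last by rewrite horner0.
  have -> : 2 * x1 - (c * m.+2%:R)%:P * x1 ^+ 2 = x1 * (2 - (c * m.+2%:R)%:P * x1) by ring.
  by rewrite hornerM [(x1 * _).[1]]hornerM x11 mul0r mulr0.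
have DE : (\sum_(i < m.+1) D i * phi (m - i)).[1] = - \sum_(i < K) c * i.+1%:R.
  rewrite horner_sum (big_ord_widen _ (fun i => c * i.+1%:R) Km) -sumrN [RHS]big_mkcond /=.
  apply: eq_bigr => i _; rewrite hornerM phi_at1 mulr1; case: ltnP => iK.
    by rewrite mean_defect_small // hornerN hornerC.
  by rewrite IH.
have := sum_c; rewrite -mulr_sumr => sc.
rewrite -polyC_natr !hornerM !hornerD !hornerM x11 DE phi_at1 !hornerD !hornerN !hornerM
  x11.
rewrite !hornerC mul0r mulr0 subr0 mulr1 add0r mulr1 addr0 mulrN sc addNr.
by move/eqP; rewrite mulf_eq0 pnatr_eq0 => /eqP.
Qed.

Lemma cM_ge0 n : 0 <= c * n%:R. Proof. exact: mulr_ge0 c_ge0 (ler0n _ _). Qed.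

(** Set to 0 below [K], where the defect does not vanish at 1. *)
Definition mean_quotient m := if (K <= m)%N then D m %/ x1 else 0.
Local Notation psi := mean_quotient.

Lemma mean_quotientE m : (K <= m)%N -> D m = psi m * x1.
Proof.
move=> Km; rewrite /psi Km divpK // /x1 dvdp_XsubCl; apply/rootP.
exact: mean_defect_at1.
Qed.

Definition delta_sum a b := \sum_(a <= j < b) delta j.

Lemma delta_sumE a b : (a <= b)%N -> phi b = phi a + delta_sum a b * x1.
Proof.
move=> ab; rewrite /delta_sum -(subnKC ab); elim: (b - a)%N => [|n IH].
  by rewrite addn0 big_geq ?leqnn // mul0r addr0.
by rewrite addnS deltaE IH big_nat_recr ?leq_addr //= mulrDl addrA.
Qed.

Lemma norm1_delta_sum a b n : (b <= n)%N -> norm1 (delta_sum a b) <= W n.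
Proof.
move=> bn; apply: le_trans (norm1_sum _ _ _) _.
have [ba|ab] := leqP b a; first by rewrite big_geq // /W sumr_ge0 // => i _; exact: w_ge0.
have w0 r (P : pred nat) : 0 <= \sum_(i <- r | P i) w i.
  by apply: sumr_ge0 => i _; exact: w_ge0.
rewrite /W -(big_mkord xpredT w) [leRHS](@big_cat_nat _ _ _ b) //=.
by rewrite [X in _ <= X + _](@big_cat_nat _ _ _ a) ?(ltnW ab) //= ler_wpDr ?ler_wpDl.
Qed.

(** Divide [mean_defectS] by 'X - 1.  The defects below [K] are constants, and
    twice their sum is -[beta]; combined with the toll [beta * phi (p.+1 - K)]
    they leave only the differences of [phi (p - i)] and [phi (p.+1 - K)]. *)
Lemma mean_quotientS p : (K <= p.+1)%N ->
  p.+1%:R * psi p.+1 = 2 * \sum_(i < p.+1) psi i * phi (p - i)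
   + beta%:P * (x1 * psi (p.+1 - K) - (if (K <= p.+1 - K)%N then 0 else
     (c * (p.+1 - K).+1%:R)%:P))
   - (beta * c * K%:R)%:P * phi (p.+1 - K)
   - \sum_(i < K) (2 * (c * i.+1%:R))%:P * delta_sum (p.+1 - K) (p - i)
   + (if p.+1 == K.*2.-1 then gamma%:P * (2 - (c * p.+2%:R)%:P * x1) else 0).
Proof.
move=> Kp; apply: (mulIf x1_neq0).
have -> : p.+1%:R * psi p.+1 * x1 = p.+1%:R * D p.+1 by rewrite mean_quotientE // mulrA.
rewrite mean_defectS Kp.
have -> : 2 * (\sum_(i < p.+1) D i * phi (p - i)) =
  2 * (\sum_(i < p.+1) psi i * phi (p - i)) * x1
  - \sum_(i < K) (2 * (c * i.+1%:R))%:P * phi (p - i).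
  rewrite (big_ord_widen _ (fun i => (2 * (c * i.+1%:R))%:P * phi (p - i)) Kp).
  rewrite [X in _ - X]big_mkcond /= -mulrA mulr_suml !mulr_sumr -sumrB.
  apply: eq_bigr => i _; have [iK|Ki] := ltnP i K.
    rewrite mean_defect_small // /psi leqNgt iK /= !mul0r mulr0 sub0r.
    by rewrite [(2 * _)%:P]polyCM polyC_natr; ring.
  by rewrite mean_quotientE // subr0; ring.
have -> : \sum_(i < K) (2 * (c * i.+1%:R))%:P * phi (p - i) =
  (\sum_(i < K) (2 * (c * i.+1%:R))%:P * delta_sum (p.+1 - K) (p - i)) * x1
   + beta%:P * phi (p.+1 - K).
  rewrite -sum_c raddf_sum !mulr_suml -big_split /=; apply: eq_bigr => i _.
  by rewrite (@delta_sumE (p.+1 - K) (p - i)); [ring | have := ltn_ord i; lia].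
have -> : x1 * D (p.+1 - K) = (x1 * psi (p.+1 - K) -
    (if (K <= p.+1 - K)%N then 0 else (c * (p.+1 - K).+1%:R)%:P)) * x1.
  have [iK|Ki] := leqP K (p.+1 - K); first by rewrite mean_quotientE //; ring.
  by rewrite mean_defect_small // /psi leqNgt Ki /=; ring.
rewrite -[beta * c * K%:R]mulrA polyCM.
by case: (p.+1 == _); ring.
Qed.

Let a n := norm1 (psi n).
Let A n := \sum_(i < n) a i.

Lemma a_ge0 n : 0 <= a n. Proof. exact: norm1_ge0. Qed.

Lemma a_small n : (n < K)%N -> a n = 0.
Proof. by move=> nK; rewrite /a /psi leqNgt nK norm1C normr0. Qed.

(** The norms of the terms of [mean_quotientS].  The differences of laws cost
    [beta * W n], at most 44 (n + 1) / K^2 by [W_bound]; the terms with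
    c K <= 2 / (K + 1) are absorbed by raising 44 to 52; the cross term has norm
    at most 3 because c (n + 1) is small at its index. *)
Lemma a_step n : (48 <= K)%N -> (K <= n)%N ->
  K%:R ^+ 2 * (n%:R * a n) <= 2 * (K%:R ^+ 2 * A n) + 4 * (K%:R ^+ 2 * a (n - K))
     + 52 * n.+1%:R + 3 * K%:R ^+ 2 * (n == K.*2.-1)%:R.
Proof.
move=> K48; have K48R : 48 <= (K%:R : R) by rewrite (ler_nat _ 48).
case: n => [|p] Kp; first by lia.
have cK : c * K%:R * (K%:R + 1) = beta by rewrite natr1 KcE.
have cK2 : c * K%:R <= 1 / 24.
  have := cK; have := c_ge0; have := beta_le2; nra.
have step : p.+1%:R * a p.+1 <= 2 * A p.+1 + (4 * a (p.+1 - K) + 2 * (c * K%:R))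
   + 2 * (c * K%:R) + 2 * W p.+1 + 3 * (p.+1 == K.*2.-1)%:R.
  rewrite /a -norm1natM mean_quotientS //.
  apply: le_trans (norm1D _ _) _; apply: lerD; last first.
    case: eqP => [E1|_]; last by rewrite norm1C normr0 mulr0.
    rewrite norm1CM ger0_norm // mulr1.
    have cp : c * p.+2%:R <= 2 * (c * K%:R).
      rewrite mulrCA ler_wpM2l ?c_ge0 // -natrM ler_nat; lia.
    have n2 : norm1 (2 : {poly R}) = 2 by rewrite -polyC_natr norm1C ger0_norm.
    have := norm1D 2 (- ((c * p.+2%:R)%:P * x1)); rewrite n2 norm1N.
    have := norm1x1 ((c * p.+2%:R)%:P); rewrite -/x1 mulrC norm1C.
    rewrite ger0_norm ?cM_ge0 // => h1 h2.
    have := gamma_le1; have := gamma_ge0; have := norm1_ge0 (2 - (c * p.+2%:R)%:P * x1).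
    nra.
  apply: le_trans (norm1D _ _) _; rewrite norm1N; apply: lerD; last first.
    apply: le_trans (norm1_sum _ _ _) _.
    apply: (@le_trans _ _ (\sum_(i < K) (2 * (c * i.+1%:R)) * W p.+1)).
      apply: ler_sum => i _; have c2 := mulr_ge0 (ler0n R 2) (cM_ge0 i.+1).
      by rewrite norm1CM ger0_norm // ler_wpM2l // norm1_delta_sum //; lia.
    rewrite -mulr_suml sum_c ler_wpM2r ?beta_le2 // sumr_ge0 // => i _; exact: w_ge0.
  have bcK : 0 <= beta * c * K%:R by rewrite -mulrA; exact: mulr_ge0 beta_ge0 (cM_ge0 _).
  have bcK2 : beta * c * K%:R <= 2 * (c * K%:R).
    by rewrite -mulrA ler_wpM2r ?beta_le2 ?cM_ge0.
  apply: le_trans (norm1D _ _) _; rewrite norm1N; apply: lerD; last first.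
    rewrite norm1CM ger0_norm //; apply: le_trans bcK2.
    by rewrite -[leRHS]mulr1 ler_wpM2l.
  apply: le_trans (norm1D _ _) _; apply: lerD.
    rewrite norm1natM ler_wpM2l //.
    apply: le_trans (norm1_sum _ _ _) _; apply: ler_sum => i _.
    apply: le_trans (norm1M _ _) _.
    by rewrite -[leRHS]mulr1 ler_wpM2l ?norm1_ge0.
  rewrite norm1CM ger0_norm ?beta_ge0 //.
  have := norm1D (x1 * psi (p.+1 - K)) (-
    (if (K <= p.+1 - K)%N then 0 else (c * (p.+1 - K).+1%:R)%:P)).
  have := norm1x1 (psi (p.+1 - K)); rewrite -/x1 norm1N.
  have : norm1 (if (K <= p.+1 - K)%N then 0 else (c * (p.+1 - K).+1%:R)%:P) <= c * K%:R.
    case: leqP => h; rewrite norm1C ?normr0 ?cM_ge0 // ger0_norm ?cM_ge0 //.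
    by rewrite ler_wpM2l ?c_ge0 // ler_nat.
  set G := norm1 (_ - _) => h1 h2 h3; have G0 : 0 <= G by exact: norm1_ge0.
  have : beta * G <= 2 * G by rewrite ler_wpM2r ?beta_le2.
  by rewrite -!/(a _) in h2 *; move: h1 h2 h3; move: (norm1 (if _ then _ else _)) => N; lra.
have := W_bound p.+1 K48.
have : K%:R <= p.+1%:R :> R by rewrite ler_nat.
rewrite -[p.+2%:R]natr1.
move: step; move: ((p.+1 == _)%:R) (a p.+1) (a (p.+1 - K)) (A _) (W _) (p.+1%:R) =>
  s b d e v x h1 h2 h3.
have k0 : 0 < (K%:R : R) ^+ 2 by rewrite exprn_gt0 //; lra.
have : K%:R ^+ 2 * (x * b) <= K%:R ^+ 2 *
  (2 * e + (4 * d + 2 * (c * K%:R)) + 2 * (c * K%:R) + 2 * v + 3 * s).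
  by rewrite ler_wpM2l // ltW.
have : K%:R ^+ 2 * (c * K%:R) <= 2 * (K%:R : R).
  move: cK (cM_ge0 K) beta_le2; set y := c * K%:R => cK y0 b2.
  have yk : y * K%:R <= 2 by lra.
  by have : K%:R * (y * K%:R) <= K%:R * 2 :> R; [rewrite ler_wpM2l | lra].
lra.
Qed.

Lemma a_le_A i n : (i < n)%N -> a i <= A n.
Proof.
move=> lin; rewrite /A (bigD1 (Ordinal lin)) //= lerDl.
by apply: sumr_ge0 => j _; exact: a_ge0.
Qed.

(** Replace the delayed term [a (n - K)] in [a_step] by the whole sum [A n]. *)
Lemma a_from_A n : (48 <= K)%N -> (K <= n)%N ->
  K%:R ^+ 3 * A n <= 129 * (n%:R * n.+1%:R) ->
  K%:R ^+ 3 * a n <= 826 * n.+1%:R + 3 * K%:R ^+ 2 * (n == K.*2.-1)%:R.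
Proof.
move=> K48 Kn hA; have K48R : 48 <= (K%:R : R) by rewrite (ler_nat _ 48).
have KnR : K%:R <= n%:R :> R by rewrite ler_nat.
have aA : a (n - K) <= A n by apply: a_le_A; lia.
have n0 : 0 < n%:R :> R by lra.
have := a_step K48 Kn.
have s0 : 0 <= (n == K.*2.-1)%:R :> R by [].
move: hA; rewrite -[n.+1%:R]natr1.
move: aA KnR n0 s0; move: (a n) (a (n - K)) (A n) (n%:R) (K%:R) ((n == _)%:R) K48R.
move=> x y z m k s k48 yz km m0 s0 hA hs.
have k0 : 0 < k by lra.
rewrite -(ler_pM2l m0).
have : k * (k ^+ 2 * (m * x)) <= k * (6 * (k ^+ 2 * z) + 52 * (m + 1) + 3 * k ^+ 2 * s).
  rewrite ler_pM2l //; apply: le_trans hs _.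
  have : k ^+ 2 * y <= k ^+ 2 * z by rewrite ler_wpM2l ?sqr_ge0.
  by lra.
have : k * (m + 1) <= m * (m + 1) by rewrite ler_wpM2r //; lra.
have : (k ^+ 2 * s) * k <= (k ^+ 2 * s) * m by rewrite ler_wpM2l // mulr_ge0 ?sqr_ge0.
by rewrite !exprS !expr0 !mulr1 in hA *; lra.
Qed.

Let E' n := (K.*2.-1 < n)%N.

(** By [a_step], A n / (n (n + 1)) grows by at most the source divided by
    n (n + 1) (n + 2).  The source is of order (n + 1) / K^2, so that the sum
    over n >= K is of order 1 / K^3; it is telescoped through the term n - K.
    The delayed term [a (n - K)] is estimated by [a_from_A] and the induction
    hypothesis: it is smaller by a factor K, which is where K >= 48 enters. *)
Lemma A_bound_sharp n : (48 <= K)%N -> (K <= n)%N ->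
  K%:R ^+ 3 * A n <= 128 * (n.+1%:R * (n%:R - K%:R)) + n%:R * n.+1%:R * (E' n)%:R.
Proof.
move=> K48; have K48R : 48 <= (K%:R : R) by rewrite (ler_nat _ 48).
elim/ltn_ind: n => -[|n] IH; first by lia.
rewrite leq_eqVlt => /orP[/eqP Kn1|Kn].
  have -> : A n.+1 = 0 by apply: big1 => i _; rewrite a_small //; have := ltn_ord i; lia.
  by rewrite -Kn1 subrr !mulr0 add0r !mulr_ge0.
have KnR : K%:R <= n%:R :> R by rewrite ler_nat.
(* The source is at most the increment of the telescoping term. *)
have aK : 4 * (K%:R ^+ 2 * a (n - K)) + 52 * n.+1%:R <= 128 * n.+2%:R.
  have [h|h] := ltnP (n - K) K.
    by rewrite a_small // !mulr0 add0r -[n.+2%:R]natr1; have := ler0n R n.+1; lra.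
  have hA : K%:R ^+ 3 * A (n - K) <= 129 * ((n - K)%:R * (n - K).+1%:R).
    apply: le_trans (IH _ _ h) _; first by lia.
    rewrite -[(n - K).+1%:R]natr1; have := ler0n R (n - K).
    have : (E' (n - K))%:R <= 1 :> R by case: (E' _).
    by move: ((E' _)%:R) => e; nra.
  have := a_from_A K48 h hA.
  have h2 : 2 * K%:R <= n%:R :> R by rewrite -natrM ler_nat; lia.
  have : (n - K == K.*2.-1)%N%:R <= 1 :> R by case: (_ == _).
  rewrite -[(n - K).+1%:R]natr1 natrB; last by lia.
  rewrite -[n.+2%:R]natr1 -[n.+1%:R]natr1.
  move: h2; move: ((n - K == _)%N%:R) (a _) (n%:R) (K%:R) K48R => s x m k k48 mk s1 H.
  have k0 : 0 < k by lra.
  rewrite -(ler_pM2l k0).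
  have : 3 * k ^+ 2 * s <= 3 * k ^+ 2 by rewrite ler_piMr // mulr_ge0 ?sqr_ge0.
  have : 48 * (m - k + 1) <= k * (m - k + 1) by rewrite ler_wpM2r //; lra.
  have : k * (2 * k) <= k * m by rewrite ler_wpM2l //; lra.
  by rewrite !exprS !expr0 !mulr1 in H *; nra.
have := IH n (ltnSn _) Kn; have := a_step K48 Kn.
have : K%:R ^+ 3 * (n == K.*2.-1)%:R * 3 <= n%:R * n.+1%:R * n.+2%:R * (n == K.*2.-1)%:R :>
  R.
  case: eqP => [->|_]; last by rewrite /= mulr0n !mulr0 mul0r.
  rewrite /= mulr1n !mulr1 -natrX -!natrM ler_nat.
  have K2K : (K.*2.-1 = K + K.-1)%N by lia.
  rewrite K2K !expnS expn0 muln1; nia.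
have -> : (E' n.+1 : nat) = (E' n + (n == K.*2.-1))%N by rewrite /E'; case: eqP; lia.
have -> : A n.+1 = A n + a n by rewrite /A big_ord_recr.
rewrite natrD.
move: aK KnR; rewrite -[n.+2%:R]natr1 -[n.+1%:R]natr1.
move: ((E' n)%:R) ((n == _)%:R) (a (n - K)) (a n) (A n) (n%:R) (K%:R) K48R =>
  e s y x z m k k48 hy km hs h1 h2.
have m0 : 0 < m by lra.
rewrite -(ler_pM2l m0).
have P1 : k * (k ^+ 2 * (m * x)) <= k * (2 * (k ^+ 2 * z) + 128 * (m + 1 + 1) + 3 * k ^+ 2
  * s).
  by rewrite ler_wpM2l //; lra.
have P2 : (m + 2) * (k ^+ 3 * z) <= (m + 2) * (128 * ((m + 1) * (m - k)) + m * (m + 1) * e).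
  by rewrite ler_wpM2l //; lra.
rewrite !exprS !expr0 !mulr1 in P1 P2 hs *; lra.
Qed.

(** The exceptional index is the only one at which both children of the root
    can have [K] leaves. *)
Theorem mean_quotient_bound n : (48 <= K)%N -> (K <= n)%N ->
  K%:R ^+ 3 * norm1 (psi n) <= 826 * n.+1%:R + 3 * K%:R ^+ 2 * (n == K.*2.-1)%:R.
Proof.
move=> K48 Kn; apply: a_from_A => //; apply: le_trans (A_bound_sharp K48 Kn) _.
have : K%:R <= n%:R :> R by rewrite ler_nat.
have : (E' n)%:R <= 1 :> R by case: (E' _).
have := ler0n R K; rewrite -[n.+1%:R]natr1; move: ((E' _)%:R) (n%:R) (K%:R) => e m k.
by nra.
Qed.

End recursion.

(** * Stein's method for the Poisson distribution *)

Section stein.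
Variables (R : realType) (lam : R).
Hypothesis lam_gt0 : 0 < lam.
Local Notation pmf := (poisson_pmf lam).

(** The probability of {0, ..., n - 1}, without n itself. *)
Definition poisson_cdf n := \sum_(i < n) pmf i.
Local Notation F := poisson_cdf.

Lemma poisson_pmfE l : pmf l = expR (- lam) * lam ^+ l / l`!%:R.
Proof. by rewrite /poisson_pmf lam_gt0 mulrC mulrA. Qed.

Lemma poisson_pmf_gt0 l : 0 < pmf l.
Proof.
by rewrite poisson_pmfE divr_gt0 ?mulr_gt0 ?expR_gt0 ?exprn_gt0 // ltr0n fact_gt0.
Qed.

Lemma poisson_pmfS l : lam * pmf l = l.+1%:R * pmf l.+1.
Proof.
rewrite !poisson_pmfE exprS factS natrM.
by field; rewrite nat1r !pnatr_eq0 -lt0n fact_gt0.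
Qed.

Lemma poisson_cdfS n : F n.+1 = F n + pmf n.
Proof. by rewrite /F big_ord_recr. Qed.

Lemma poisson_cdf_cvg : F @ \oo --> (1 : R).
Proof.
have -> : F = (fun n => expR (- lam) * series (exp_coeff lam) n).
  apply/funext => n; rewrite /F /series /= big_mkord mulr_sumr.
  by apply: eq_bigr => i _; rewrite poisson_pmfE /exp_coeff /= mulrA.
rewrite (_ : 1 = expR (- lam) * expR lam); last by rewrite expRN mulVf ?gt_eqF ?expR_gt0.
apply: cvgMr; exact: is_cvg_series_exp_coeff.
Qed.

Lemma poisson_cdf_nondecreasing : nondecreasing_seq F.
Proof. by apply/nondecreasing_seqP => n; rewrite poisson_cdfS lerDl poisson_pmf_ge0. Qed.

Lemma poisson_cdf_le1 n : F n <= 1.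
Proof.
rewrite -(cvg_lim _ poisson_cdf_cvg) //.
by apply: nondecreasing_cvgn_le; [exact: poisson_cdf_nondecreasing|apply/cvg_ex; exists 1;
  exact: poisson_cdf_cvg].
Qed.

Lemma poisson_cdf_lub y : (forall n, F n <= y) -> 1 <= y.
Proof.
move=> Fy; rewrite -(cvg_lim _ poisson_cdf_cvg) //.
by apply: limr_le; [apply/cvg_ex; exists 1; exact: poisson_cdf_cvg | exact: nearW].
Qed.

Lemma poisson_size_bias n : lam * F n = \sum_(i < n) i.+1%:R * pmf i.+1.
Proof. by rewrite /F mulr_sumr; apply: eq_bigr => i _; exact: poisson_pmfS. Qed.

Lemma poisson_cdf_shift l : lam * F l.+1 <= l.+1%:R * (F l.+2 - pmf 0).
Proof.
rewrite poisson_size_bias.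
have -> : F l.+2 - pmf 0 = \sum_(i < l.+1) pmf i.+1.
  by rewrite /F big_ord_recl /= addrAC subrr add0r.
rewrite mulr_sumr.
apply: ler_sum => i _; rewrite ler_wpM2r ?poisson_pmf_ge0 // ler_nat.
exact: ltn_ord.
Qed.

(** The terms of the upper tail satisfy i pmf(i) = lam pmf(i - 1) with
    i > l; compare the finite sums and let their length tend to infinity. *)
Lemma poisson_tail_shift l : l.+1%:R * (1 - F l.+2) <= lam * (1 - F l.+1).
Proof.
have step d : l.+1%:R * (F (l.+2 + d) - F l.+2) <= lam * (F (l.+1 + d) - F l.+1).
  elim: d => [|d IH]; first by rewrite !addn0 !subrr !mulr0.
  have h : l.+1%:R * pmf (l.+2 + d) <= lam * pmf (l.+1 + d).
    by rewrite poisson_pmfS -addSn ler_wpM2r ?poisson_pmf_ge0 // ler_nat; lia.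
  by rewrite (poisson_cdfS (l.+1 + d)) in IH;
    rewrite !addnS (poisson_cdfS (l.+2 + d)) (poisson_cdfS (l.+1 + d)); lra.
have l0 : 0 < l.+1%:R :> R by [].
rewrite -ler_pdivlMl // lerBlDr; apply: poisson_cdf_lub => n.
rewrite -lerBlDr ler_pdivlMl //.
apply: (@le_trans _ _ (l.+1%:R * (F (l.+2 + n) - F l.+2))).
  by rewrite ler_wpM2l // lerD2r poisson_cdf_nondecreasing // leq_addl.
apply: le_trans (step n) _.
by rewrite ler_wpM2l ?(ltW lam_gt0) // lerD2r poisson_cdf_le1.
Qed.

(** The value at l + 1 of the solution f of the Stein equation
    lam f(l + 1) - l f(l) = [l = j] - pmf(j).  The shift leaves out f(0), which
    the equation does not determine. *)
Definition stein_sol j l := pmf j * ((j <= l)%N%:R - F l.+1) / (lam * pmf l).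

Lemma stein_sol0 j : lam * stein_sol j 0 = (j == 0)%N%:R - pmf j.
Proof.
rewrite /stein_sol leqn0 poisson_cdfS {1}/F big_ord0 add0r.
have p0 := poisson_pmf_gt0 0; case: eqP => [->|_] /=; field; rewrite ?gt_eqF //.
Qed.

Lemma stein_solS j l :
  lam * stein_sol j l.+1 - l.+1%:R * stein_sol j l = (j == l.+1)%N%:R - pmf j.
Proof.
rewrite /stein_sol (poisson_pmfS l) (poisson_cdfS l.+1).
have p0 := poisson_pmf_gt0 l.+1.
have -> : ((j <= l.+1)%N%:R = (j <= l)%N%:R + (j == l.+1)%N%:R :> R).
  by rewrite -natrD; congr _%:R; case: eqP; lia.
have -> : pmf j * (((j <= l)%N%:R + (j == l.+1)%N%:R) - (F l.+1 + pmf l.+1))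
  / (lam * pmf l.+1) =
  pmf j * ((j <= l)%N%:R - F l.+1) / (lam * pmf l.+1) + pmf j
    * ((j == l.+1)%N%:R - pmf l.+1) / (lam * pmf l.+1).
  by field; rewrite ?gt_eqF.
by case: (j =P l.+1) => [->|_] /=; field; rewrite nat1r !gt_eqF.
Qed.

Definition stein_factor := (1 - pmf 0) / lam.

Lemma stein_factor_ge0 : 0 <= stein_factor.
Proof.
rewrite divr_ge0 ?(ltW lam_gt0) // subr_ge0.
by apply: le_trans (poisson_cdf_le1 1); rewrite /F big_ord1.
Qed.

Lemma stein_factor_le1 : stein_factor <= 1.
Proof.
rewrite ler_pdivrMr // mul1r poisson_pmfE expr0 fact0 mulr1 divr1.
have := expR_ge1Dx (- lam); lra.
Qed.

Lemma stein_factor_leV : stein_factor <= lam^-1.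
Proof.
rewrite ler_pdivrMr // mulVf ?gt_eqF // gerBl; exact: poisson_pmf_ge0.
Qed.

(** The solution for a singleton has one increasing step.  Before it, the
    solution is a negative multiple of F(l + 1) / pmf(l), which increases; after
    it, a positive multiple of (1 - F(l + 1)) / pmf(l), which decreases. *)
Lemma stein_sol_le_other j l : j != l.+1 -> stein_sol j l.+1 <= stein_sol j l.
Proof.
move=> jl; have p0 := poisson_pmf_gt0 l.+1; have p1 := poisson_pmf_gt0 l.
have ratio x y : l.+1%:R * y <= lam * x -> y / (lam * pmf l.+1) <= x / (lam * pmf l).
  move=> xy; rewrite (poisson_pmfS l) ler_pdivrMr ?mulr_gt0 //.
  rewrite [leRHS](_ : _ = (lam * x) / l.+1%:R); last by field; rewrite nat1r !gt_eqF.
  by rewrite ler_pdivlMr // mulrC.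
rewrite /stein_sol -!mulrA ler_wpM2l ?poisson_pmf_ge0 //; apply: ratio.
have -> : (j <= l.+1)%N = (j <= l)%N by move/eqP: jl; lia.
case: leqP => _ /=; first exact: poisson_tail_shift.
rewrite !mulr0n !sub0r !mulrN lerN2.
apply: le_trans (poisson_cdf_shift l) _.
by rewrite ler_wpM2l // gerBl poisson_pmf_ge0.
Qed.

Lemma stein_sol_same l : stein_sol l.+1 l.+1 - stein_sol l.+1 l <= stein_factor.
Proof.
have p0 := poisson_pmf_gt0 l.+1; have p1 := poisson_pmf_gt0 l.
rewrite /stein_sol leqnn ltnn /= (poisson_pmfS l).
rewrite [leLHS](_ : _ = (1 - F l.+2 + lam * F l.+1 / l.+1%:R) / lam); last first.
  by field; rewrite nat1r !gt_eqF.
rewrite ler_pM2r ?invr_gt0 //.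
have : lam * F l.+1 / l.+1%:R <= F l.+2 - pmf 0.
  by rewrite ler_pdivrMr // [leRHS]mulrC poisson_cdf_shift.
move: (_ / l.+1%:R) => x; lra.
Qed.

(** The solution for {0, ..., n - 1} is a positive multiple of the increasing
    ratio F(l + 1) / pmf(l) as long as l < n. *)
Lemma stein_sol_full n l : (l.+1 < n)%N ->
  0 <= \sum_(j < n) (stein_sol j l.+1 - stein_sol j l).
Proof.
move=> ln; have full m : (m < n)%N ->
    \sum_(j < n) stein_sol j m = (1 - F n) * (F m.+1 / (lam * pmf m)).
  move=> mn; rewrite (eq_bigr (fun j : 'I_n => (if (j < m.+1)%N then pmf j else 0)
    / (lam * pmf m)
      - pmf j * (F m.+1 / (lam * pmf m)))); last first.
    move=> j _; rewrite /stein_sol ltnS mulrA -mulrBl; case: leqP => _ /=.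
      by rewrite mulrBr mulr1.
    by rewrite mulr0n sub0r mulrN sub0r.
  rewrite sumrB -!mulr_suml -big_mkcond -(big_ord_widen n pmf) //= -!/(F _).
  by ring.
rewrite sumrB !full ?(ltnW ln) // -mulrBr mulr_ge0 ?subr_ge0 ?poisson_cdf_le1 //.
have := @stein_sol_le_other l.+2 l; rewrite /stein_sol.
have p0 := poisson_pmf_gt0 l.+2.
have f1 : (l.+2 <= l.+1)%N = false by lia.
have f2 : (l.+2 <= l)%N = false by lia.
rewrite f1 f2.
rewrite !mulr0n !sub0r -!mulrA ler_pM2l // !mulNr lerN2.
by apply; lia.
Qed.

(** The increment of the solution for a set is the sum of those for its
    points, of which at most one is positive.  This is the upper bound; the
    lower bound is the upper bound for the complement in {0, ..., n - 1}, by
    [stein_sol_full]. *)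
Lemma stein_sol_smooth (A : pred nat) n l : (l.+1 < n)%N ->
  `| \sum_(j < n | A j) stein_sol j l.+1 - \sum_(j < n | A j) stein_sol j l | <=
    stein_factor.
Proof.
move=> ln; rewrite -sumrB.
have upper (B : pred nat) : \sum_(j < n | B j) (stein_sol j l.+1 - stein_sol j l) <=
  stein_factor.
  have := @stein_sol_same l; have := stein_factor_ge0.
  rewrite big_mkcond /= (bigD1 (Ordinal ln)) //= => b0 hl.
  rewrite -[leRHS]addr0 lerD //; first by case: ifP.
  apply: sumr_le0 => i il; case: ifP => // _.
  by rewrite subr_le0 stein_sol_le_other //; apply: contraNneq il => e; apply/eqP/val_inj.
rewrite ler_norml upper andbT.
have := upper (predC A); have := stein_sol_full ln.
rewrite (bigID (fun j : 'I_n => A j)) /=; lra.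
Qed.

(** Pair p^`() - lam p with the solution g for A.  By the Stein equation this is
    the difference of the probabilities of A up to sign; by the factorisation
    and summation by parts it is the pairing of [psi] with increments of g. *)
Theorem stein_poly_bound (p psi : {poly R}) (A : pred nat) N :
  (size p <= N.+1)%N -> (size psi <= N)%N -> p.[1] = 1 ->
  p^`() - lam%:P * p = psi * ('X - 1) ->
  `| \sum_(l < N.+1 | A l) (p`_l - pmf l) | <= norm1 psi * stein_factor.
Proof.
move=> sp spsi p1 dp.
pose g l := \sum_(j < N.+1 | A j) stein_sol j l.
(* At l = 0 the value of g at l.-1 is multiplied by 0. *)
have gE l : lam * g l - l%:R * g l.-1 = \sum_(j < N.+1 | A j) ((j == l :> nat)%:R - pmf j).
  rewrite /g !mulr_sumr -sumrB; apply: eq_bigr => j _.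
  by case: l => [|l]; rewrite ?mul0r ?subr0 ?stein_sol0 ?stein_solS.
have -> : \sum_(l < N.+1 | A l) (p`_l - pmf l) =
    \sum_(l < N.+1) p`_l * (lam * g l - l%:R * g l.-1).
  under [RHS]eq_bigr do rewrite gE mulr_sumr.
  rewrite exchange_big /=; apply: eq_bigr => j _.
  under eq_bigr do rewrite mulrBr; rewrite sumrB -mulr_suml.
  have -> : \sum_(i < N.+1) p`_i = 1.
    rewrite -p1 (horner_coef_wide _ sp); apply: eq_bigr => i _.
    by rewrite expr1n mulr1.
  rewrite mul1r (bigD1 j) //= eqxx mulr1 big1 ?addr0 // => i ij.
  by rewrite eq_sym (inj_eq val_inj) (negbTE ij) mulr0.
have -> : \sum_(l < N.+1) p`_l * (lam * g l - l%:R * g l.-1) =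
    - \sum_(l < N.+1) (p^`() - lam%:P * p)`_l * g l.
  under eq_bigr do rewrite mulrBr; rewrite sumrB [X in _ - X]big_ord_recl /= mul0r mulr0
    add0r.
  under [in RHS]eq_bigr do rewrite coefB coefCM coef_deriv mulrBl.
  rewrite sumrB opprB [X in _ = _ - X]big_ord_recr /= [p`_N.+1]nth_default // mul0rn mul0r
    addr0.
  congr (_ - _); apply: eq_bigr => i _; first by ring.
  by rewrite /bump /= add1n mulrA mulr_natr.
rewrite dp normrN.
have -> : \sum_(l < N.+1) (psi * ('X - 1))`_l * g l = \sum_(l < N) psi`_l * (g l.+1 - g l).
  under eq_bigr do rewrite mulrBr mulr1 coefB coefMX mulrBl.
  rewrite sumrB big_ord_recl /= mul0r add0r big_ord_recr /= [psi`_N]nth_default // mul0r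
    addr0.
  by rewrite -sumrB; apply: eq_bigr => i _; rewrite mulrBr.
apply: le_trans (ler_norm_sum _ _ _) _.
rewrite (norm1E spsi) mulr_suml; apply: ler_sum => l _.
by rewrite normrM ler_wpM2l // stein_sol_smooth // ltnS.
Qed.

End stein.

(** * Total variation distance of an integer-valued law to a Poisson law *)

Section preimage.
Context (R : realType) (d : measure_display) (T : measurableType d).
Variables (X : T -> nat).
Hypothesis mX : forall l, measurable (X @^-1` [set l]).

Lemma measurable_preimage_nat (A : set nat) : measurable (X @^-1` A).
Proof.
have -> : X @^-1` A = \bigcup_(l in A) X @^-1` [set l].
  apply/seteqP; split => [w Aw|w [l Al /= Xw]]; first by exists (X w).
  by rewrite /preimage /= Xw.
exact: bigcup_measurable.
Qed.

Lemma measure_preimage_finite (mu : {measure set T -> \bar R}) (A : set nat) n :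
  mu (X @^-1` [set l | (l < n)%N /\ A l]) =
  (\sum_(l < n | (l : nat) \in A) mu (X @^-1` [set (l : nat)]))%E.
Proof.
elim: n => [|n IH].
  rewrite big_ord0 (_ : [set l | _] = set0) ?preimage_set0 ?measure0 //.
  by apply/seteqP; split => // l [].
rewrite big_mkcond big_ord_recr /= -big_mkcond -IH.
case: ifPn => nA.
  have -> : [set l | (l < n.+1)%N /\ A l] = [set l | (l < n)%N /\ A l] `|` [set n].
    apply/seteqP; split => l /=.
      by rewrite ltnS leq_eqVlt => -[/orP[/eqP ->|ln] Al]; [right|left].
    by move=> [[ln Al]|->]; [split; [exact: ltnW|]|split=> //; apply: set_mem].
  rewrite preimage_setU measureU //; [exact: measurable_preimage_nat|].
  by apply/seteqP; split => // w /= [[+ _] Xw]; rewrite Xw ltnn.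
rewrite adde0; congr (mu (X @^-1` _)); apply/seteqP; split => l /= [].
  rewrite ltnS leq_eqVlt => /orP[/eqP ->|//] /mem_set; by rewrite (negbTE nA).
by move=> ln; split => //; exact: ltnW.
Qed.

Lemma measure_preimage_ge (mu : {measure set T -> \bar R}) (A : set nat) n :
  (\sum_(l < n | (l : nat) \in A) mu (X @^-1` [set (l : nat)]) <= mu (X @^-1` A))%E.
Proof.
rewrite -measure_preimage_finite le_measure ?inE //; [exact: measurable_preimage_nat..|].
by apply: preimage_subset => l [].
Qed.

End preimage.

Section law.
Context (R : realType) (d : measure_display) (T : measurableType d).
Variables (X : T -> nat) (P : probability T R) (p : {poly R}).
Hypothesis mX : forall l, measurable (X @^-1` [set l]).
Hypothesis PX : forall l, P (X @^-1` [set l]) = (p`_l)%:E.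
Hypothesis p1 : p.[1] = 1.
Local Notation N := (size p).

(** Finite additivity gives the lower bound for A and for its complement, and
    the two lower bounds add up to 1. *)
Lemma law_preimage (A : set nat) :
  P (X @^-1` A) = (\sum_(l < N | (l : nat) \in A) p`_l)%:E.
Proof.
have lo B : ((\sum_(l < N | (l : nat) \in B) p`_l)%:E <= P (X @^-1` B))%E.
  apply: le_trans (measure_preimage_ge mX P B N).
  by rewrite -sumEFin; apply: lee_sum => l _; rewrite -PX.
have mA := measurable_preimage_nat mX A.
have Pf : P (X @^-1` A) \is a fin_num by exact: fin_num_measure.
have := lo (~` A); have := lo A.
rewrite preimage_setC probability_setC // -(fineK Pf) -EFinB !lee_fin => h1 h2.
congr (_%:E); apply/le_anti; rewrite h1 andbT.
have : \sum_(l < N) p`_l = 1.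
  by rewrite -p1 horner_coef; apply: eq_bigr => i _; rewrite expr1n mulr1.
rewrite (bigID (fun l : 'I_N => (l : nat) \in A)) /=.
have eC : \sum_(l < N | (l : nat) \in ~` A) p`_l = \sum_(l < N | (l : nat) \notin A) p`_l.
  by apply: eq_bigl => l; rewrite classical_sets.in_setC.
by rewrite eC in h2; lra.
Qed.

Lemma law_expectation : expect_nat P X = (p^`().[1])%:E.
Proof.
rewrite /expect_nat unlock.
have XE : setT = \bigcup_l X @^-1` [set l].
  by apply/seteqP; split => // w _; exists (X w).
rewrite XE ge0_integral_bigcup //; last 2 first.
- rewrite -XE; apply/measurable_EFinP => _ B mB; rewrite setTI.
  exact: (measurable_preimage_nat mX [set l | B l%:R]).
- by move=> i j _ _ [w [/= <- <-]].
rewrite (eq_eseriesr (g := fun l => (l%:R * p`_l)%:E)); last first.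
  move=> l _; rewrite (eq_integral (cst (l%:R%:E))); last by move=> w /set_mem /= ->.
  by rewrite integral_cst // EFinM -PX.
have mean n : (N <= n)%N -> \sum_(0 <= i < n) i%:R * p`_i = p^`().[1].
  move=> Nn; rewrite big_mkord (@horner_coef_wide _ n); last first.
    by apply: leq_trans (size_poly _ _) _; apply: leq_trans (leq_pred _) Nn.
  case: n Nn => [|n] Nn; first by rewrite !big_ord0.
  rewrite big_ord_recl mul0r add0r [RHS]big_ord_recr /= coef_deriv.
  rewrite [p`_n.+1]nth_default // mul0rn mul0r addr0.
  by apply: eq_bigr => i _; rewrite /bump add1n coef_deriv expr1n mulr1 mulr_natl.
apply/cvg_lim => //; apply: cvg_near_cst; near=> n.
by rewrite sumEFin mean //; near: n; exists N.
Unshelve. all: by end_near. Qed.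

Let lam := p^`().[1].
Hypothesis lam_gt0 : 0 < lam.
Local Notation pmf := (poisson_pmf lam).

(** The difference of the two probabilities of the set on which the weights of
    [p] exceed the Poisson weights.  Those are positive, so this set is bounded
    by the size of [p]. *)
Definition excess := \sum_(l < N | pmf l < p`_l) (p`_l - pmf l).

Let id_nat (l : nat) : measurable (id @^-1` [set l]).
Proof. by []. Qed.

Lemma poisson_prob_set1 l : poisson_prob lam 0 [set l] = (pmf l)%:E.
Proof.
by rewrite /poisson_prob lam_gt0 esum_set1 // lee_fin poisson_pmf_ge0.
Qed.

Lemma poisson_prob_ge (A : set nat) :
  ((\sum_(l < N | (l : nat) \in A) pmf l)%:E <= poisson_prob lam 0 A)%E.
Proof.
have := measure_preimage_ge id_nat (poisson_prob lam 0) A N.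
rewrite preimage_id; apply: le_trans.
rewrite -sumEFin; apply: lee_sum => l _.
by rewrite preimage_id /= -poisson_prob_set1.
Qed.

Lemma law_excess (A : set nat) :
  (P (X @^-1` A) - poisson_prob lam 0 A <= excess%:E)%E.
Proof.
rewrite law_preimage; apply: (@le_trans _ _ ((\sum_(l < N | (l : nat) \in A) p`_l)%:E -
   (\sum_(l < N | (l : nat) \in A) pmf l)%:E)%E).
  by apply: leeB => //; exact: poisson_prob_ge.
rewrite -EFinB lee_fin -sumrB /excess big_mkcond [leRHS]big_mkcond /=.
apply: ler_sum => l _; case: ifP => _; case: ltP; lra.
Qed.

(** The supremum is attained on the set that defines [excess].  Passing to the
    complement changes the sign of a difference of probabilities, which takes
    care of the absolute value. *)
Lemma dTV_poisson_excess : dTV_poisson P X = excess%:E.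
Proof.
rewrite /dTV_poisson law_expectation -/lam /= /dTV.
have fin A : poisson_prob lam 0 A \is a fin_num by apply: fin_num_measure.
apply/le_anti/andP; split.
  apply: ge_ereal_sup => _ [A mA <-]; rewrite /pushforward.
  have nuC : poisson_prob lam 0 (~` A) = (1 - fine (poisson_prob lam 0 A))%:E.
    by rewrite (probability_setC (poisson_prob lam 0)) // EFinB fineK.
  have := law_excess (~` A); have := law_excess A.
  rewrite preimage_setC probability_setC; last exact: measurable_preimage_nat.
  rewrite nuC law_preimage -(fineK (fin A)) -!EFinB /= !lee_fin ler_norml => h1 h2.
  apply/andP; split; lra.
apply: ereal_sup_ubound; exists [set l | (l < N)%N /\ pmf l < p`_l] => //.
rewrite /pushforward law_preimage.
rewrite -[X in poisson_prob _ _ X](preimage_id) (measure_preimage_finite id_nat).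
rewrite (eq_bigr (fun l : 'I_N => (pmf l)%:E)); last first.
  by move=> l _; exact: poisson_prob_set1.
rewrite sumEFin -EFinB.
rewrite (eq_bigl (fun l : 'I_N => pmf l < p`_l)); last first.
  by move=> l; apply/idP/idP => [/set_mem[]//|h]; apply/mem_set.
rewrite [X in (_ - X)%:E](eq_bigl (fun l : 'I_N => pmf l < p`_l)); last first.
  by move=> l; apply/idP/idP => [/set_mem//|h]; apply/mem_set.
rewrite -sumrB -/excess abse_EFin ger0_norm //.
by apply: sumr_ge0 => l /ltW; rewrite subr_ge0.
Qed.

(** |x| = 2 max(x, 0) - x, and the differences of the weights sum to 0. *)
Lemma half_l1_poisson_excess : half_l1_poisson P X = excess%:E.
Proof.
rewrite /half_l1_poisson law_expectation -/lam /=.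
rewrite (eq_eseriesr (g := fun l => `|p`_l - pmf l|%:E)); last first.
  by move=> l _; rewrite PX -poisson_pmfE.
have partial n : (N <= n)%N ->
    \sum_(0 <= l < n) `|p`_l - pmf l| = 2 * excess - 1 + poisson_cdf lam n.
  move=> Nn; rewrite big_mkord.
  have -> : excess = \sum_(l < n) (if pmf l < p`_l then p`_l - pmf l else 0).
    rewrite /excess (big_ord_widen_cond n (fun l => pmf l < p`_l) (fun l => p`_l - pmf l)
      Nn).
    rewrite big_mkcond; apply: eq_bigr => l _; case: (ltnP l N) => Nl; rewrite ?andbT //.
    by rewrite andbF [p`_l]nth_default // ltNge poisson_pmf_ge0.
  have s1 : \sum_(l < n) p`_l = 1.
    by rewrite -p1 (horner_coef_wide _ Nn); apply: eq_bigr => i _; rewrite expr1n mulr1.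
  rewrite -[X in _ = _ - X + _]s1 /poisson_cdf mulr_sumr -sumrB -big_split /=;
    apply: eq_bigr => l _.
  case: ltP => h; first by rewrite ger0_norm; lra.
  by rewrite ler0_norm; lra.
have -> : excess%:E = ((2^-1)%:E * (2 * excess - 1 + 1)%:E)%E.
  by rewrite -EFinM subrK mulKf.
congr (_ * _)%E; apply/cvg_lim => //.
have : ((2 * excess - 1 + poisson_cdf lam n)%:E @[n --> \oo] --> (2 * excess - 1 + 1)%:E)%E.
  apply: cvg_EFin; first exact: nearW.
  apply: cvgD; [exact: cvg_cst|exact: poisson_cdf_cvg].
apply: cvg_trans; apply: near_eq_cvg; near=> n.
by rewrite sumEFin partial //; near: n; exists N.
Unshelve. all: by end_near. Qed.

End law.

(** * Poisson approximation for split recursions *)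

Section excess_bound.
Variable R : realType.

Lemma excess_le1 (p : {poly R}) : (forall l, 0 <= p`_l) -> p.[1] = 1 -> excess p <= 1.
Proof.
move=> p0 p1; rewrite -p1 horner_coef /excess big_mkcond; apply: ler_sum => l _.
rewrite expr1n mulr1; case: ifP => // _.
by rewrite gerBl poisson_pmf_ge0.
Qed.

Lemma excess_le_stein (p psi : {poly R}) : p.[1] = 1 -> 0 < p^`().[1] ->
  p^`() - (p^`().[1])%:P * p = psi * ('X - 1) ->
  excess p <= norm1 psi * stein_factor p^`().[1].
Proof.
move=> p1 lam_gt0 dp; set lam := p^`().[1] in lam_gt0 dp *.
pose N := maxn (size p) (size psi).
have := stein_poly_bound lam_gt0 (fun l => poisson_pmf lam l < p`_l) (N := N).
move=> /(_ p psi) /(_ (leq_trans (leq_maxl _ _) (leqnSn _)) (leq_maxr _ _) p1 dp).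
apply: le_trans; apply: le_trans (ler_norm _).
rewrite /excess (big_ord_widen_cond N.+1 (fun l => poisson_pmf lam l < p`_l)
  (fun l => p`_l - poisson_pmf lam l)); last by apply: leq_trans (leq_maxl _ _) (leqnSn _).
rewrite (eq_bigl (fun l : 'I_N.+1 => poisson_pmf lam l < p`_l)) // => l.
case: ltnP => h; rewrite ?andbT // andbF.
by rewrite [p`_l]nth_default // ltNge poisson_pmf_ge0.
Qed.

Variables (K : nat) (beta gamma : R) (phi : nat -> {poly R}).
Hypothesis K_gt0 : (0 < K)%N.
Hypothesis beta_ge1 : 1 <= beta.
Hypothesis beta_le2 : beta <= 2.
Hypothesis gamma_ge0 : 0 <= gamma.
Hypothesis gamma_le1 : gamma <= 1.
Hypothesis phi0 : phi 0 = 1.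
Hypothesis phi_at1 : forall m, (phi m).[1] = 1.
Hypothesis phi_ge0 : forall m l, 0 <= (phi m)`_l.
Hypothesis phiS : split_recursion K beta gamma phi.

Lemma norm1_phi m : norm1 (phi m) <= 1.
Proof.
rewrite -(phi_at1 m) horner_coef /norm1; apply: ler_sum => i _.
by rewrite expr1n mulr1 ger0_norm.
Qed.

Lemma recursion_mean n : (K <= n)%N ->
  (phi n)^`().[1] = beta * n.+1%:R / (K%:R * K.+1%:R).
Proof.
move=> Kn; have := mean_defect_at1 K_gt0 beta_ge1 beta_le2 gamma_ge0 gamma_le1 phi0 phi_at1
  phiS Kn.
rewrite /mean_defect hornerD hornerN hornerM phi_at1 hornerC mulr1 => /eqP.
by rewrite subr_eq0 => /eqP ->; rewrite mulrAC.
Qed.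

(** Apart from one index, lam is of order (n + 1) / K^2 and the Stein factor is
    bounded by 1 / lam.  At the exceptional index n is about 2 K, and the bound
    of the Stein factor by 1 is sufficient.  For K < 48 the distance is at most
    1, which is less than 1655 / K. *)
Theorem recursion_excess n : (K <= n)%N -> excess (phi n) <= 1655 / K%:R.
Proof.
move=> Kn; have K0 : 0 < (K%:R : R) by rewrite ltr0n.
have [K48|K48] := ltnP K 48.
  apply: le_trans (excess_le1 (phi_ge0 n) (phi_at1 n)) _.
  rewrite ler_pdivlMr // mul1r; apply: le_trans (_ : 48 <= 1655); last by lra.
  by rewrite (ler_nat _ _ 48) ltnW.
have mean := recursion_mean Kn.
have lam0 : 0 < (phi n)^`().[1].
  by rewrite mean divr_gt0 ?mulr_gt0 // (lt_le_trans ltr01 beta_ge1).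
have dp := mean_quotientE K_gt0 beta_ge1 beta_le2 gamma_ge0 gamma_le1 phi0 phi_at1 phiS Kn.
rewrite /mean_defect mulrAC -mean in dp.
apply: le_trans (excess_le_stein (phi_at1 n) lam0 dp) _.
have := mean_quotient_bound K_gt0 beta_ge1 beta_le2 gamma_ge0 gamma_le1 phi0 phi_at1
  norm1_phi phiS K48 Kn.
have := norm1_ge0 (mean_quotient K beta phi n); set a := norm1 _ => a0.
rewrite ler_pdivlMr //.
have k48 : 48 <= (K%:R : R) by rewrite (ler_nat _ 48).
have k2 : 0 < (K%:R : R) ^+ 2 by rewrite exprn_gt0.
case: eqP => [nE|_] /= ab.
  have : a * stein_factor (phi n)^`().[1] <= a by rewrite ler_piMr // stein_factor_le1.
  move=> h; apply: le_trans (_ : a * K%:R <= _); first by rewrite ler_pM2r.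
  rewrite -(ler_pM2l k2).
  have : n.+1%:R <= 2 * K%:R :> R by rewrite -natrM ler_nat nE; lia.
  by move: (n.+1%:R) ab => m ab hm; move: (K%:R) K0 k48 k2 ab hm => k *; nra.
have h : a * stein_factor (phi n)^`().[1] <= a * ((phi n)^`().[1])^-1.
  by rewrite ler_wpM2l // stein_factor_leV.
apply: le_trans (_ : a * ((phi n)^`().[1])^-1 * K%:R <= _); first by rewrite ler_pM2r.
rewrite mulr0n mulr0 addr0 in ab; rewrite mulrAC ler_pdivrMr // mean.
have n0 : 0 < n.+1%:R :> R by [].
rewrite !mulrA ler_pdivlMr ?mulr_gt0 // -[K.+1%:R]natr1.
have := beta_ge1; move: n.+1%:R n0 ab => m m0 ab b1.
move: (K%:R) K0 k48 k2 ab => k k0 k48 k2 ab.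
have h1 : k * k * a * (k + 1) <= 1652 * m.
  rewrite -(ler_pM2r k0).
  have : (k ^+ 3 * a) * (k + 1) <= 826 * m * (k + 1) by rewrite ler_wpM2r //; lra.
  by rewrite !exprS expr0; nra.
have : 1652 * m <= 1655 * beta * m by rewrite ler_pM2r //; lra.
rewrite /=; lra.
Qed.

End excess_bound.

(** * Binary trees grown by splitting leaves *)

(** The leaves are the empty positions of a binary search tree, and the nodes of
    a recursive tree. *)
Inductive btree := Leaf | Br of btree & btree.

Fixpoint leaves (t : btree) : nat :=
  if t is Br a b then leaves a + leaves b else 1.

(** The trees that arise by replacing one leaf by a node with two leaves, in the
    order of the leaves. *)
Fixpoint splits (t : btree) : seq btree :=
  if t is Br a b then [seq Br a' b | a' <- splits a] ++ [seq Br a b' | b' <- splits b]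
  else [:: Br Leaf Leaf].

(** The trees with [m] nodes, each listed once for every sequence of splits
    that leads to it; the uniform distribution on this list is the random
    tree after [m] uniform splits. *)
Fixpoint shapes (m : nat) : seq btree :=
  if m is m'.+1 then flatten [seq splits t | t <- shapes m'] else [:: Leaf].

Lemma size_splits t : size (splits t) = leaves t.
Proof. by elim: t => //= a <- b <-; rewrite size_cat !size_map. Qed.

Lemma leaves_splits t : all (fun t' => leaves t' == (leaves t).+1) (splits t).
Proof.
elim: t => //= a IHa b IHb; rewrite all_cat !all_map; apply/andP; split.
  by apply: sub_all IHa => t /= /eqP ->.
by apply: sub_all IHb => t /= /eqP ->; rewrite addnS.
Qed.

Lemma leaves_shapes m : all (fun t => leaves t == m.+1) (shapes m).
Proof.
elim: m => //= m; elim: (shapes m) => //= t s IH /andP[/eqP lt /IH al].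
by rewrite all_cat al andbT -lt leaves_splits.
Qed.

Lemma size_shapes m : size (shapes m) = m`!.
Proof.
elim: m => //= m IH; rewrite factS -IH size_flatten /shape -map_comp.
elim: (shapes m) (leaves_shapes m) => [|t s IHs] /=; first by rewrite muln0.
by move=> /andP[/eqP lt /IHs ->]; rewrite size_splits lt mulnS.
Qed.

Lemma big_flatten_map (V : nmodType) (A B : Type) (f : A -> seq B) (s : seq A) (F : B -> V)
  :
  \sum_(b <- flatten [seq f a | a <- s]) F b = \sum_(a <- s) \sum_(b <- f a) F b.
Proof. by rewrite big_flatten big_map. Qed.

Lemma eq_big_all (V : nmodType) (A : Type) (P : pred A) (s : seq A) (F G : A -> V) :
  all P s -> (forall a, P a -> F a = G a) -> \sum_(a <- s) F a = \sum_(a <- s) G a.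
Proof.
move=> + FG; elim: s => [|a s IH]; first by rewrite !big_nil.
by move=> /= /andP[Pa Ps]; rewrite !big_cons FG // IH.
Qed.

(** The next split takes place in the left or in the right child, so the number
    of ways to interleave the splits of the two children satisfies Pascal's
    rule. *)
Lemma sum_shapes_split (V : nmodType) m (F : btree -> V) :
  \sum_(t <- shapes m.+1) F t =
  \sum_(i < m.+1) (\sum_(a <- shapes i) \sum_(b <- shapes (m - i)) F (Br a b)) *+ 'C(m, i).
Proof.
elim: m F => [|m IH] F; first by rewrite big_ord1 /= !big_seq1 bin0 mulr1n.
rewrite [shapes m.+2]/= big_flatten_map IH.
pose G i j := \sum_(a <- shapes i) \sum_(b <- shapes j) F (Br a b).
have -> : \sum_(i < m.+1) (\sum_(a <- shapes i) \sum_(b <- shapes (m - i))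
      \sum_(t <- splits (Br a b)) F t) *+ 'C(m, i) =
    \sum_(i < m.+1) G i.+1 (m - i)%N *+ 'C(m, i)
      + \sum_(i < m.+1) G i (m.+1 - i)%N *+ 'C(m, i).
  rewrite -big_split /=; apply: eq_bigr => i _; rewrite -mulrnDl; congr (_ *+ _).
  rewrite subSn; last by rewrite -ltnS.
  rewrite /G [shapes i.+1]/= big_flatten_map -big_split /=; apply: eq_bigr => a _.
  rewrite big_flatten_map exchange_big -big_split /=; apply: eq_bigr => b _.
  by rewrite big_cat !big_map.
rewrite [RHS]big_ord_recl [X in _ + X = _]big_ord_recl /= !bin0 !mulr1n subn0 addrCA;
  congr (_ + _).
rewrite -/(G _ _).
under [RHS]eq_bigr => i _ do rewrite /bump add1n subSS binS mulrnDr -/(G i.+1 (m - i)%N).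
rewrite big_split /= addrC; congr (_ + _).
rewrite [RHS]big_ord_recr /= bin_small // mulr0n addr0.
by apply: eq_bigr => i _; rewrite /bump add1n subSS.
Qed.

Section fringe.
Variables (e : bool) (K : nat).

(** Right children with [K] leaves are counted always, left children only if
    [e] holds.  The root is not counted. *)
Fixpoint fringe_count (t : btree) : nat :=
  if t is Br a b then
    fringe_count a + fringe_count b + (e && (leaves a == K)) + (leaves b == K)
  else 0.

Lemma leaves_gt0 t : (0 < leaves t)%N.
Proof. by elim: t => //= a a0 b b0; rewrite addn_gt0 a0. Qed.

Lemma fringe_count_small t : (leaves t <= K)%N -> fringe_count t = 0%N.
Proof.
elim: t => //= a IHa b IHb tK; have a0 := leaves_gt0 a; have b0 := leaves_gt0 b.
rewrite IHa ?IHb; [|lia..].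
have -> : (leaves a == K) = false by lia.
have -> : (leaves b == K) = false by lia.
by rewrite andbF.
Qed.

Variable R : realFieldType.

Definition fringe_pgf m : {poly R} :=
  (m`!%:R^-1)%:P * \sum_(t <- shapes m) 'X^(fringe_count t).
Local Notation phi := fringe_pgf.

Lemma coef_fringe_pgf m l :
  (phi m)`_l = (count (fun t => fringe_count t == l) (shapes m))%:R / m`!%:R.
Proof.
rewrite coefCM mulrC coef_sum; congr (_ / _).
by rewrite -sum1_count natr_sum [RHS]big_mkcond; apply: eq_bigr => t _;
  rewrite coefXn eq_sym; case: eqP.
Qed.

Lemma fact_neq0 m : (m`!%:R : R) != 0.
Proof. by rewrite pnatr_eq0 -lt0n fact_gt0. Qed.

Lemma sum_fringe m : \sum_(t <- shapes m) 'X^(fringe_count t) = m`!%:R * phi m :> {poly R}.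
Proof. by rewrite /phi -polyC_natr mulrA -polyCM mulfV ?fact_neq0 // mul1r. Qed.

Lemma fringe_pgf_ge0 m l : 0 <= (phi m)`_l.
Proof. by rewrite coef_fringe_pgf divr_ge0. Qed.

Lemma fringe_pgf_small m : (m < K)%N -> phi m = 1.
Proof.
move=> mK; rewrite /phi (eq_big_all (G := fun=> 1) (leaves_shapes m)); last first.
  by move=> t /eqP lt; rewrite fringe_count_small ?lt.
by rewrite big_const_seq count_predT iter_addr addr0 size_shapes -polyC_natr -polyCM mulVf
  ?fact_neq0.
Qed.

Lemma fringe_pgf0 : phi 0 = 1.
Proof. by rewrite /phi big_seq1 fact0 invr1 mul1r. Qed.

Lemma fringe_pgf_at1 m : (phi m).[1] = 1.
Proof.
rewrite hornerM hornerC horner_sum.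
under eq_bigr do rewrite hornerXn expr1n.
by rewrite big_const_seq count_predT iter_addr addr0 size_shapes mulVf ?fact_neq0.
Qed.

(** 'C(m, i) i! (m - i)! = m!, that is, the size of the left child of the root
    is uniform. *)
Lemma fringe_pgf_split m : m.+1%:R * phi m.+1 =
  \sum_(i < m.+1) phi i * phi (m - i) * 'X^((e && (i.+1 == K)) + ((m - i).+1 == K)).
Proof.
apply: (@mulfI _ (m`!%:R)); first by rewrite -polyC_natr polyC_eq0 fact_neq0.
rewrite mulrA -natrM mulnC -factS -sum_fringe sum_shapes_split mulr_sumr.
apply: eq_bigr => i _; have im : (i <= m)%N by rewrite -ltnS.
transitivity ((i`!%:R * phi i) * ((m - i)`!%:R * phi (m - i))
  * 'X^((e && (i.+1 == K)) + ((m - i).+1 == K)) *+ 'C(m, i)).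
  congr (_ *+ _); rewrite -!sum_fringe mulr_suml [RHS]mulr_suml.
  apply: eq_big_all (leaves_shapes i) _ => a /eqP la; rewrite mulr_sumr mulr_suml.
  apply: eq_big_all (leaves_shapes (m - i)) _ => b /eqP lb.
  by rewrite /= la lb -!exprD !addnA.
rewrite -mulr_natl -(bin_fact im) !natrM; ring.
Qed.

Hypothesis K_gt0 : (0 < K)%N.

(** The counted children of the root contribute 'X = 1 + ('X - 1) each, and
    the generating function of a tree with [K] leaves is 1 since its root is
    not counted. *)
Lemma fringe_recursion : split_recursion K (1 + e%:R) e%:R phi.
Proof.
move=> m; rewrite fringe_pgf_split; set x1 := 'X - 1.
have XE : 'X = 1 + x1 :> {poly R} by rewrite /x1 addrC subrK.
rewrite (eq_bigr (fun i : 'I_m.+1 => phi i * phi (m - i)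
   + (if i == K.-1 :> nat then e%:R * x1 * phi (m - i) else 0)
   + (if i == (m.+1 - K)%N :> nat then (if (K <= m.+1)%N then x1 * phi i else 0) else 0)
   + (if (i == K.-1 :> nat) then (if m.+1 == K.*2.-1 then e%:R * x1 ^+ 2 else 0) else 0)));
     last first.
  move=> i _; have im := ltn_ord i.
  have [iK|iK] := eqVneq (i.+1) K; have [jK|jK] := eqVneq (m - i).+1 K.
  - have -> : (i == K.-1 :> nat) by lia. have -> : (i == (m.+1 - K)%N :> nat) by lia.
    have -> : (K <= m.+1)%N by lia. have -> : (m.+1 == K.*2.-1) by lia.
    rewrite !fringe_pgf_small; [|lia..].
    by case: (e); rewrite /= ?addn0 XE; ring.
  - have -> : (i == K.-1 :> nat) by lia.
    have -> : (i == (m.+1 - K)%N :> nat) = false by lia.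
    have -> : (m.+1 == K.*2.-1) = false by lia.
    rewrite (fringe_pgf_small (m := i)); last by lia.
    by case: (e); rewrite /= ?addn0 XE; ring.
  - have -> : (i == K.-1 :> nat) = false by lia.
    have -> : (i == (m.+1 - K)%N :> nat) by lia. have -> : (K <= m.+1)%N by lia.
    rewrite (fringe_pgf_small (m := m - i)); last by lia.
    by rewrite andbF /= XE; ring.
  - have -> : (i == K.-1 :> nat) = false by lia.
    have -> : (if i == (m.+1 - K)%N :> nat then (if (K <= m.+1)%N then x1 * phi i else 0)
      else 0) = 0.
      by case: eqP => // ?; case: ifP => // ?; lia.
    by rewrite andbF /= expr0; ring.
have pick j (G : nat -> {poly R}) : \sum_(i < m.+1) (if i == j :> nat then G i else 0) =
    if (j <= m)%N then G j else 0.
  case: leqP => jm.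
    rewrite (bigD1 (Ordinal (jm : (j < m.+1)%N))) //= eqxx big1 ?addr0 // => i ij.
    by rewrite ifN //; apply: contraNneq ij => h; apply/eqP/val_inj.
  by rewrite big1 // => i _; rewrite ifN //; have := ltn_ord i; lia.
rewrite !big_split /= (pick _ (fun i => e%:R * x1 * phi (m - i))).
rewrite (pick _ (fun i => if (K <= m.+1)%N then x1 * phi i else 0)).
rewrite (pick _ (fun=> if m.+1 == K.*2.-1 then e%:R * x1 ^+ 2 else 0)).
rewrite -!addrA; congr (_ + _).
rewrite -/x1 polyCD polyC_natr.
have -> : (K.-1 <= m)%N = (K <= m.+1)%N by lia.
have -> : (m.+1 - K <= m)%N by lia.
case: (leqP K m.+1) => h.
  by rewrite (_ : (m - K.-1 = m.+1 - K)%N); [case: ifP => _; ring|lia].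
by rewrite [m.+1 == _](_ : _ = false) ?addr0 //; lia.
Qed.

End fringe.

(** * The random binary search tree *)

Section permutation_sums.
Variables (T : eqType) (V : nmodType).
Implicit Types (A B w : seq T) (F : seq T -> V).

Lemma sum_permutations_perm A B F : perm_eq A B ->
  \sum_(w <- permutations A) F w = \sum_(w <- permutations B) F w.
Proof.
move=> AB; apply: perm_big; apply: uniq_perm; rewrite ?permutations_uniq // => w.
rewrite !mem_permutations; by apply: permPr.
Qed.

Lemma sum_permutations_head A F : uniq A -> (0 < size A)%N ->
  \sum_(w <- permutations A) F w =
  \sum_(x <- A) \sum_(w <- permutations (rem x A)) F (x :: w).
Proof.
move=> uA A0.
have -> : \sum_(x <- A) \sum_(w <- permutations (rem x A)) F (x :: w) =
    \sum_(w <- [seq x :: w | x <- A, w <- permutations (rem x A)]) F w.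
  by rewrite big_allpairs_dep.
apply: perm_big; apply: uniq_perm; first exact: permutations_uniq.
  apply: allpairs_uniq_dep => //; first by move=> x _; exact: permutations_uniq.
  by move=> [x w] [y v] _ _ [-> ->].
move=> w; rewrite mem_permutations; apply/idP/allpairsPdep => [wA|[x [v [xA vA ->]]]].
  case: w wA => [|x w] wA; first by rewrite -(perm_size wA) in A0.
  have xA : x \in A by rewrite -(perm_mem wA) mem_head.
  exists x, w; split=> //; rewrite mem_permutations.
  by rewrite -(perm_cons x) (perm_trans wA) // perm_to_rem.
rewrite mem_permutations in vA.
by apply: (@perm_trans _ (x :: rem x A)); rewrite ?perm_cons // perm_sym perm_to_rem.
Qed.

(** Restricted to the letters that satisfy [a] and to the other ones, a
    uniform permutation gives two independent uniform permutations.  The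
    number of shuffles obeys Pascal's rule, by the first letter. *)
Lemma sum_permutations_shuffle (a : pred T) A B (F : seq T -> seq T -> V) :
  uniq (A ++ B) -> all a A -> all (predC a) B ->
  \sum_(w <- permutations (A ++ B)) F (seq.filter a w) (seq.filter (predC a) w) =
  (\sum_(u <- permutations A) \sum_(v <- permutations B) F u v) *+
    'C(size A + size B, size A).
Proof.
move Dn : (size A + size B)%N => n; elim: n A B F Dn => [|n IH] A B F Dn uAB aA aB.
  have /nilP-> : nilp A by rewrite /nilp; lia.
  have /nilP-> : nilp B by rewrite /nilp; lia.
  by rewrite /= !big_seq1.
have [A0|A0] := posnP (size A).
  move/size0nil: A0 => ->; rewrite /= bin0 mulr1n big_seq1.
  apply: eq_big_seq => w; rewrite mem_permutations => wB.
  have /all_filterP-> : all (predC a) w by rewrite (perm_all _ wB).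
  have -> // : seq.filter a w = [::].
  apply/eqP; rewrite -[_ == _]negbK -has_filter -all_predC.
  by rewrite (perm_all _ wB).
have [B0|B0] := posnP (size B).
  rewrite B0 addn0 in Dn.
  move/size0nil: B0 => ->; rewrite cats0 /= Dn binn mulr1n.
  apply: eq_big_seq => w; rewrite mem_permutations => wA.
  rewrite big_seq1; have aw : all a w by rewrite (perm_all _ wA).
  have /all_filterP-> := aw.
  have -> // : seq.filter (predC a) w = [::].
  apply/eqP; rewrite -[_ == _]negbK -has_filter -all_predC.
  by apply: sub_all aw => x /= ->.
move: (uAB); rewrite cat_uniq => /and3P[uA AB uB].
rewrite sum_permutations_head // ?size_cat; last by lia.
rewrite big_cat /=.
have sA : size A = (size A).-1.+1 by lia.
rewrite [in RHS]sA binS mulrnDr addrC; congr (_ + _).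
- under [in RHS]eq_bigr => u _ do rewrite sum_permutations_head //.
  rewrite exchange_big -sumrMnl /=; apply: eq_big_seq => x xB.
  have ax : ~~ a x by have /allP/(_ x xB) := aB.
  have pB := perm_to_rem xB.
  have xA : x \notin A by apply: contra AB => xA; apply/hasP; exists x.
  have pr : perm_eq (rem x (A ++ B)) (A ++ rem x B).
    rewrite -(perm_cons x) -(permPl (perm_to_rem _)); last by rewrite mem_cat xB orbT.
    by rewrite -cat1s perm_sym perm_catCA perm_cat2l perm_sym.
  rewrite (sum_permutations_perm _ pr) /= ax (negbTE ax).
  rewrite (IH _ _ (fun u v => F u (x :: v))) //.
  - by rewrite -sA.
  - by rewrite size_rem //; lia.
  - by rewrite -(perm_uniq pr) rem_uniq.
  - by apply/allP => y /mem_rem; apply/allP.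
- rewrite (sum_permutations_head _ uA) // -sumrMnl /=; apply: eq_big_seq => x xA.
  have ax : a x by have /allP/(_ x xA) := aA.
  have pr : perm_eq (rem x (A ++ B)) (rem x A ++ B).
    rewrite -(perm_cons x) -(permPl (perm_to_rem _)); last by rewrite mem_cat xA.
    by rewrite -cat_cons perm_cat2r perm_to_rem.
  rewrite (sum_permutations_perm _ pr) /= ax /=.
  rewrite (IH _ _ (fun u v => F (x :: u) v)) //.
  - by rewrite size_rem.
  - by rewrite size_rem //; lia.
  - by rewrite -(perm_uniq pr) rem_uniq.
  - by apply/allP => y /mem_rem; apply/allP.
Qed.

End permutation_sums.

Section bst.

Fixpoint bst_shape (t : bintree) : btree :=
  if t is Node l _ r then Br (bst_shape l) (bst_shape r) else Leaf.

Definition bst_of (w : seq nat) : bintree := foldl (fun t x => bst_insert x t) Defs.Empty w.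

Lemma bst_of_cons x w :
  bst_of (x :: w) = Node (bst_of (seq.filter (fun y => y < x)%N w)) x
                         (bst_of (seq.filter (predC (fun y => y < x)%N) w)).
Proof.
have gen l r : foldl (fun t y => bst_insert y t) (Node l x r) w =
  Node (foldl (fun t y => bst_insert y t) l (seq.filter (fun y => y < x)%N w)) x
       (foldl (fun t y => bst_insert y t) r (seq.filter (predC (fun y => y < x)%N) w)).
  by elim: w l r => //= y w IH l r; case: ifP => _; rewrite IH.
exact: gen.
Qed.

Lemma leaves_bst_shape t : leaves (bst_shape t) = (bintree_size t).+1.
Proof. by elim: t => //= l -> _ r ->; rewrite addSn addnS. Qed.

(** A subtree with k nodes has k + 1 empty positions. *)
Lemma bintree_subtreesE k t : (0 < k)%N ->
  bintree_subtrees k t = (fringe_count true k.+1 (bst_shape t) + (bintree_size t == k))%N.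
Proof.
move=> k0; elim: t => [|l IHl x r IHr] /=; first by rewrite eq_sym eqn0Ngt k0.
by rewrite IHl IHr !leaves_bst_shape !eqSS; lia.
Qed.

Definition rank (A : seq nat) x := count (fun y => y < x)%N A.

Lemma rank_lt (a : pred nat) A x : x \in A -> a x -> (forall y, (y < x)%N -> a y) ->
  (rank A x < count a A)%N.
Proof.
move=> xA ax lta.
have := count_predUI (fun y => y < x)%N (pred1 x) A.
have -> : count (predI (fun y => y < x)%N (pred1 x)) A = 0%N.
  by rewrite (eq_count (a2 := pred0)) ?count_pred0 // => y /=; case: eqP => [->|];
    rewrite ?ltnn ?andbF.
have : (0 < count_mem x A)%N by rewrite -has_count has_pred1.
have : (count (predU (fun y => y < x)%N (pred1 x)) A <= count a A)%N.
  by apply: sub_count => y /= /orP[/lta|/eqP->].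
rewrite -/(rank A x).
by move: (count (predU _ _) A) (count_mem x A) (rank A x) (count a A); lia.
Qed.

Lemma perm_rank A : uniq A -> perm_eq [seq rank A x | x <- A] (iota 0 (size A)).
Proof.
move=> uA.
have uR : uniq [seq rank A x | x <- A].
  rewrite map_inj_in_uniq // => x y xA yA rxy.
  have [lt|lt|//] := ltngtP x y.
    by have := rank_lt xA lt (fun z zx => ltn_trans zx lt); rewrite -/(rank A y) rxy ltnn.
  by have := rank_lt yA lt (fun z zx => ltn_trans zx lt); rewrite -/(rank A x) rxy ltnn.
have sub : {subset [seq rank A x | x <- A] <= iota 0 (size A)}.
  move=> _ /mapP[x xA ->]; rewrite mem_iota /= add0n -(count_predT A).
  exact: (rank_lt (a := predT)).
have [|_ mE] := uniq_min_size uR sub; first by rewrite size_map size_iota.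
by apply: uniq_perm; rewrite ?iota_uniq.
Qed.

(** The first key x is the root, and the keys below and above x form independent
    uniform permutations; the rank of x is uniform.  This is the recursion
    [sum_shapes_split]. *)
Lemma sum_bst_of (V : nmodType) A (F : btree -> V) : uniq A ->
  \sum_(w <- permutations A) F (bst_shape (bst_of w)) = \sum_(t <- shapes (size A)) F t.
Proof.
move Dm : (size A) => m; elim/ltn_ind: m A F Dm => m IH A F Dm uA.
case: m Dm IH => [|m] Dm IH.
  by move/size0nil: Dm => ->; rewrite /= !big_seq1.
rewrite sum_permutations_head // ?Dm // sum_shapes_split.
pose H i := (\sum_(a <- shapes i) \sum_(b <- shapes (m - i)) F (Br a b)) *+ 'C(m, i).
rewrite -(big_mkord xpredT H) /index_iota subn0 -Dm -(perm_big _ (perm_rank uA)) big_map.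
apply: eq_big_seq => x xA.
pose lo := (fun y => y < x)%N.
have szlo : size (seq.filter lo (rem x A)) = rank A x.
  rewrite size_filter /rank (seq.permP (perm_to_rem xA)) /= /lo ltnn //.
have szhi : size (seq.filter (predC lo) (rem x A)) = (m - rank A x)%N.
  have := count_predC lo (rem x A); rewrite -szlo !size_filter size_rem // Dm /=; lia.
have rm : (rank A x <= m)%N.
  by have := count_predC lo (rem x A); rewrite -szlo !size_filter size_rem // Dm /=; lia.
have pr : perm_eq (rem x A) (seq.filter lo (rem x A) ++ seq.filter (predC lo) (rem x A)).
  by rewrite perm_sym perm_filterC.
rewrite (sum_permutations_perm _ pr).
rewrite (eq_bigr (fun w => F (Br (bst_shape (bst_of (seq.filter lo w)))
      (bst_shape (bst_of (seq.filter (predC lo) w)))))); last by move=> w _;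
        rewrite bst_of_cons.
rewrite (@sum_permutations_shuffle _ _ lo _ _
   (fun u v => F (Br (bst_shape (bst_of u)) (bst_shape (bst_of v))))); first last.
- exact: filter_all.
- exact: filter_all.
- by rewrite -(perm_uniq pr) rem_uniq.
have IHlo (G : btree -> V) : \sum_(u <- permutations (seq.filter lo (rem x A)))
    G (bst_shape (bst_of u)) = \sum_(t <- shapes (rank A x)) G t.
  by apply: IH; rewrite ?filter_uniq ?rem_uniq.
have IHhi (G : btree -> V) : \sum_(u <- permutations (seq.filter (predC lo) (rem x A)))
    G (bst_shape (bst_of u)) = \sum_(t <- shapes (m - rank A x)) G t.
  by apply: IH; rewrite ?filter_uniq ?rem_uniq // ltnS leq_subr.
rewrite szlo szhi subnKC // /H; congr (_ *+ _).
rewrite (IHlo (fun a => \sum_(v <- permutations (seq.filter (predC lo) (rem x A)))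
   F (Br a (bst_shape (bst_of v))))).
by apply: eq_bigr => a _; rewrite (IHhi (fun b => F (Br a b))).
Qed.

Definition keys n (s : 'S_n) : seq nat := [seq (s i).+1 | i <- enum 'I_n].

Lemma perm_keys n : perm_eq [seq keys s | s : 'S_n] (permutations (iota 1 n)).
Proof.
have uK : uniq [seq keys s | s : 'S_n].
  rewrite map_inj_uniq ?enum_uniq // => s t st; apply/perm.permP => i.
  apply/val_inj/succn_inj; have /eq_in_map := st; apply; exact: mem_enum.
have sub : {subset [seq keys s | s : 'S_n] <= permutations (iota 1 n)}.
  move=> _ /fintype.imageP[s _ ->]; rewrite mem_permutations.
  have uk : uniq (keys s).
    rewrite map_inj_uniq ?enum_uniq // => i j [/val_inj/perm_inj]; exact.
  have subk : {subset keys s <= iota 1 n}.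
    by move=> _ /mapP[i _ ->]; rewrite mem_iota /= add1n ltnS ltn_ord.
  have [|_ mk] := uniq_min_size uk subk; first by rewrite size_iota size_map size_enum_ord.
  by apply: uniq_perm => //; rewrite iota_uniq.
have [|_ mE] := uniq_min_size uK sub.
  by rewrite size_permutations ?iota_uniq // size_iota size_map -cardE card_Sn.
by apply: uniq_perm; rewrite ?permutations_uniq.
Qed.

Theorem sum_bst_of_perm (V : nmodType) n (F : btree -> V) :
  \sum_(s : 'S_n) F (bst_shape (bst_of_perm s)) = \sum_(t <- shapes n) F t.
Proof.
have -> : shapes n = shapes (size (iota 1 n)) by rewrite size_iota.
rewrite -sum_bst_of ?iota_uniq // -(perm_big _ (perm_keys n)) /=.
by rewrite big_map big_enum.
Qed.

End bst.

(** * The random recursive tree *)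

Section recursive_trees.
Local Open Scope nat_scope.

(** A recursive tree as a binary tree with labelled leaves.  In [LBr a b], the
    right part [b] is the subtree of the oldest child of the root, and [a] is
    what remains when this subtree is removed; the root is the leftmost leaf.
    In this encoding attaching a node to [q] splits the leaf [q], as [grow]
    does. *)
Inductive ltree := LLeaf of nat | LBr of ltree & ltree.

Fixpoint labels (t : ltree) : seq nat :=
  match t with LLeaf x => [:: x] | LBr a b => labels a ++ labels b end.

Fixpoint root_label (t : ltree) : nat :=
  match t with LLeaf x => x | LBr a _ => root_label a end.

Fixpoint unlabel (t : ltree) : btree :=
  match t with LLeaf _ => Leaf | LBr a b => Br (unlabel a) (unlabel b) end.

Fixpoint grow (q i : nat) (t : ltree) : ltree :=
  match t with
  | LLeaf x => if x == q then LBr (LLeaf x) (LLeaf i) else LLeaf x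
  | LBr a b => LBr (grow q i a) (grow q i b)
  end.

(** The labels of the largest subterm whose leftmost leaf is [v]. *)
Fixpoint descendants (t : ltree) (v : nat) : seq nat :=
  match t with
  | LLeaf x => if x == v then [:: x] else [::]
  | LBr a b => if v == root_label a then labels a ++ labels b
               else descendants a v ++ descendants b v
  end.

Lemma size_labels t : size (labels t) = leaves (unlabel t).
Proof. by elim: t => //= a IHa b IHb; rewrite size_cat IHa IHb. Qed.

Lemma labels_root t : labels t = root_label t :: behead (labels t).
Proof. by elim: t => //= a -> b _. Qed.

Lemma root_in_labels t : root_label t \in labels t.
Proof. by rewrite labels_root mem_head. Qed.

Lemma descendants_sub t v : {subset descendants t v <= labels t}.
Proof.
elim: t => [x|a IHa b IHb] u /=; first by case: eqP.
by case: eqP => // _; rewrite !mem_cat => /orP[/IHa->//|/IHb->]; rewrite orbT.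
Qed.

Lemma descendants_nil t v : v \notin labels t -> descendants t v = [::].
Proof.
elim: t => [x|a IHa b IHb] /=; first by rewrite inE eq_sym => /negbTE ->.
rewrite mem_cat negb_or => /andP[va vb].
rewrite ifN ?IHa ?IHb //; apply: contraNneq va => ->; exact: root_in_labels.
Qed.

Lemma descendants_root t : descendants t (root_label t) = labels t.
Proof. by case: t => [x|a b] /=; rewrite eqxx. Qed.

Lemma uniq_descendants t v : uniq (labels t) -> uniq (descendants t v).
Proof.
elim: t => [x|a IHa b IHb] /=; first by case: eqP.
case: eqP => // _; rewrite !cat_uniq => /and3P[/IHa -> ab /IHb ->]; rewrite andbT /=.
by apply: contra ab => /hasP[u /descendants_sub ub /descendants_sub ua]; apply/hasP;
  exists u.
Qed.

Lemma grow_id q i t : q \notin labels t -> grow q i t = t.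
Proof.
elim: t => [x|a IHa b IHb] /=; first by rewrite inE eq_sym => /negbTE ->.
by rewrite mem_cat negb_or => /andP[/IHa -> /IHb ->].
Qed.

Lemma root_grow q i t : root_label (grow q i t) = root_label t.
Proof. by elim: t => //= x; case: eqP. Qed.

Lemma mem_labels_grow q i t u :
  (u \in labels (grow q i t)) = (u \in labels t) || ((u == i) && (q \in labels t)).
Proof.
elim: t => [x|a IHa b IHb] /=.
  by rewrite [q \in _]inE eq_sym; case: eqP => _; rewrite !inE ?andbT ?andbF ?orbF.
by rewrite !mem_cat IHa IHb; case: (u == i); case: (q \in labels a); case: (q \in labels b);
  case: (u \in labels a); case: (u \in labels b).
Qed.

Lemma uniq_labels_grow q i t : uniq (labels t) -> i \notin labels t ->
  uniq (labels (grow q i t)).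
Proof.
elim: t => [x|a IHa b IHb] /=; first by case: eqP => //= _ _; rewrite !inE eq_sym andbT.
rewrite !cat_uniq mem_cat negb_or => /and3P[ua ab ub] /andP[ia ib].
rewrite IHa // IHb // andbT /=; apply: contra ab => /hasP[u].
rewrite !mem_labels_grow => ub' ua'; apply/hasP.
have [ui|ui] := eqVneq u i.
  rewrite ui (negbTE ia) (negbTE ib) eqxx /= in ua' ub'.
  by exists q.
by rewrite (negbTE ui) !orbF in ua' ub'; exists u.
Qed.

Lemma mem_descendants_grow q i t u v : v != i -> i \notin labels t ->
  (u \in descendants (grow q i t) v) =
  (u \in descendants t v) || ((u == i) && (q \in descendants t v)).
Proof.
move=> vi; elim: t => [x|a IHa b IHb] /=.
  rewrite inE => ix; case: (x =P q) => [<-|xq] /=.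
    rewrite [v == x]eq_sym; case: (x =P v) => _ /=;
      last by rewrite eq_sym (negbTE vi) in_nil andbF.
    by rewrite !inE eqxx andbT.
  case: (x =P v) => _; last by rewrite !in_nil andbF.
  by rewrite [q \in _]inE [q == x]eq_sym; move/eqP/negbTE: xq => ->; rewrite andbF orbF.
rewrite mem_cat negb_or => /andP[ia ib]; rewrite root_grow.
case: eqP => _; rewrite !mem_cat ?mem_labels_grow ?IHa ?IHb //.
  by case: (u == i); case: (q \in labels a); case: (q \in labels b);
  case: (u \in labels a); case: (u \in labels b).
by case: (u == i); case: (q \in descendants a v); case: (q \in descendants b v);
  case: (u \in descendants a v); case: (u \in descendants b v).
Qed.

Lemma mem_descendants_new q i t u : i \notin labels t ->
  (u \in descendants (grow q i t) i) = (u == i) && (q \in labels t).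
Proof.
elim: t => [x|a IHa b IHb] /=.
  rewrite !inE => ix; rewrite [q == x]eq_sym; case: (x =P q) => _ /=.
    by rewrite (negbTE ix) [x == i]eq_sym (negbTE ix) eqxx /= inE andbT.
  by rewrite eq_sym (negbTE ix) andbF.
rewrite !mem_cat negb_or => /andP[ia ib]; rewrite root_grow ifN.
  by rewrite mem_cat IHa // IHb // -andb_orr.
by apply: contraNneq ia => ->; exact: root_in_labels.
Qed.

(** A largest subterm with given leftmost leaf is the whole tree or a right
    child, and conversely; so the fringe subtrees correspond to the right
    children and the root. *)
Lemma count_descendants k t : uniq (labels t) ->
  count (fun v => size (descendants t v) == k) (labels t) =
  (fringe_count false k (unlabel t) + (leaves (unlabel t) == k))%N.
Proof.
elim: t => [x|a IHa b IHb]; first by rewrite /= eqxx addn0.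
rewrite [labels _]/= cat_uniq => /and3P[ua ab ub]; rewrite count_cat.
have -> : count (fun v => size (descendants (LBr a b) v) == k) (labels b) =
    count (fun v => size (descendants b v) == k) (labels b).
  apply: eq_in_count => v vb /=.
  have va : v \notin labels a by apply: contra ab => va; apply/hasP; exists v.
  rewrite ifN ?(@descendants_nil a) //.
  by apply: contraNneq va => ->; exact: root_in_labels.
rewrite IHb //; have := IHa ua; rewrite labels_root /= descendants_root size_labels eqxx.
rewrite size_cat !size_labels.
have -> : count (fun v => size (if v == root_label a then labels a ++ labels b
      else descendants a v ++ descendants b v) == k) (behead (labels a)) =
    count (fun v => size (descendants a v) == k) (behead (labels a)).
  apply: eq_in_count => v va /=; move: ua; rewrite labels_root => /andP[ra _].
  have va' : v \in labels a by rewrite labels_root inE va orbT.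
  rewrite ifN; last by apply: contraNneq ra => <-.
  rewrite (@descendants_nil b) ?cats0 //.
  by apply: contra ab => vb; apply/hasP; exists v.
by move: (count _ _) => c; lia.
Qed.

Lemma splits_unlabel i t : uniq (labels t) ->
  [seq unlabel (grow j i t) | j <- labels t] = splits (unlabel t).
Proof.
elim: t => [x|a IHa b IHb] /=; first by rewrite eqxx.
rewrite cat_uniq map_cat => /and3P[/IHa <- ab /IHb <-]; rewrite -!map_comp; congr (_ ++ _).
  apply/eq_in_map => j ja /=; rewrite (@grow_id _ _ b) //.
  by apply: contra ab => jb; apply/hasP; exists j.
apply/eq_in_map => j jb /=; rewrite (@grow_id _ _ a) //.
by apply: contra ab => ja; apply/hasP; exists j.
Qed.

Section recursive_tree.

Fixpoint tree_of_parents (p : nat -> nat) (m : nat) : ltree :=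
  if m is m'.+1 then grow (p m.+1) m.+1 (tree_of_parents p m') else LLeaf 1.

Lemma eq_tree_of_parents p p' m : (forall i, (1 < i <= m.+1)%N -> p i = p' i) ->
  tree_of_parents p m = tree_of_parents p' m.
Proof.
elim: m => //= m IH pp; rewrite pp ?ltnSn // IH // => i /andP[i1 im].
by rewrite pp // i1 ltnW.
Qed.

Variable p : nat -> nat.

Definition valid_parents m := forall i, (1 < i <= m.+1)%N -> (1 <= p i < i)%N.

Lemma valid_parentsW m : valid_parents m.+1 -> valid_parents m.
Proof. by move=> pv i /andP[i1 im]; apply: pv; rewrite i1 ltnW. Qed.

Lemma labels_tree m : valid_parents m ->
  uniq (labels (tree_of_parents p m)) /\
  forall u, (u \in labels (tree_of_parents p m)) = (1 <= u <= m.+1)%N.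
Proof.
elim: m => [|m IH] pv; first by split=> //= u; rewrite inE; lia.
have [um mE] := IH (valid_parentsW pv); split=> /=.
  by apply: uniq_labels_grow => //; rewrite mE; lia.
have := pv m.+2; rewrite ltnSn /= => /(_ isT) pm u.
rewrite mem_labels_grow !mE; case: eqP => [->|]; lia.
Qed.

Lemma perm_labels_tree m : valid_parents m ->
  perm_eq (labels (tree_of_parents p m)) (iota 1 m.+1).
Proof.
move=> /labels_tree[ul mE]; apply: uniq_perm; rewrite ?iota_uniq // => u.
by rewrite mE mem_iota; lia.
Qed.

(** This recursion along the path to the root characterises reachability by
    parent steps. *)
Lemma mem_descendants_tree m u v : valid_parents m -> (1 <= v <= m.+1)%N ->
  (u \in descendants (tree_of_parents p m) v) =
  (u == v) || ((1 < u <= m.+1)%N && (p u \in descendants (tree_of_parents p m) v)).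
Proof.
elim: m u v => [|m IH] u v pv vm.
  have -> : v = 1%N by lia.
  by rewrite /= inE; case: eqP => //=; case: ltnP => //=; lia.
have pv' := valid_parentsW pv.
have [ul mE] := labels_tree pv'.
have new : m.+2 \notin labels (tree_of_parents p m) by rewrite mE; lia.
have pm := pv m.+2; rewrite ltnSn /= in pm; have {}pm := pm isT.
set t := tree_of_parents p m in ul mE new *.
have pt : p m.+2 \in labels t by rewrite mE; lia.
rewrite [tree_of_parents _ _]/= -/t.
have [->|vi] := eqVneq v m.+2.
  rewrite !mem_descendants_new // pt !andbT.
  case: (u =P m.+2) => //= um; case: (boolP (1 < u <= m.+2)%N) => //= h.
  by have := pv u h; lia.
rewrite !mem_descendants_grow //.
have [->|um] := eqVneq u m.+2.
  rewrite eq_sym (negbTE vi) leqnn /=.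
  have -> : m.+2 \in descendants t v = false.
    by apply/negbTE; apply: contra new; apply: descendants_sub.
  have -> : (p m.+2 == m.+2) = false by lia.
  by rewrite /= orbF.
rewrite /= orbF IH //; last by lia.
case: (u == v) => //=.
have -> : (1 < u <= m.+2)%N = (1 < u <= m.+1)%N by lia.
case: (boolP (1 < u <= m.+1)%N) => //= h.
have -> : (p u == m.+2) = false by have := pv' u h; lia.
by rewrite orbF.
Qed.

Lemma rectree_subtreeE m (u v : 'I_m.+1) : valid_parents m ->
  rectree_subtree p v u = (u.+1 \in descendants (tree_of_parents p m) v.+1).
Proof.
move=> pv; have vm : (1 <= v.+1 <= m.+1)%N by rewrite /= ltn_ord.
have [_ mE] := labels_tree pv.
rewrite /rectree_subtree; apply/idP/idP => [/connectP[s]|].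
  elim: s u => [|w s IH] u /=; first by move=> _ ->;
    rewrite mem_descendants_tree ?eqxx //= ltn_ord.
  move=> /andP[/andP[u1 /eqP pu] sp] vl.
  by rewrite mem_descendants_tree // u1 /= pu (IH w) // ltn_ord orbT.
move: {2}(u : nat) (leqnn u) => n; elim: n u => [|n IH] u un.
all: rewrite mem_descendants_tree //; case/orP =>
  [/eqP[/val_inj->]|/andP[/andP[u1 um] pu]]; rewrite ?connect0 //.
  by move: u1 un; lia.
have pu' : (1 <= p u.+1 < u.+1)%N by apply: pv; rewrite u1 um.
have wm : ((p u.+1).-1 < m.+1)%N by lia.
have wE : (Ordinal wm).+1 = p u.+1 by rewrite /=; lia.
apply: (@connect_trans _ _ (Ordinal wm)).
  by apply: connect1; rewrite /rectree_child u1 wE eqxx.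
by apply: IH; [rewrite /=; lia|rewrite wE].
Qed.

Lemma rectree_subtreesE k m : valid_parents m ->
  rectree_subtrees k m.+1 p =
  (fringe_count false k (unlabel (tree_of_parents p m)) + (m.+1 == k))%N.
Proof.
move=> pv; have [ul mE] := labels_tree pv; set t := tree_of_parents p m in ul mE *.
have lt : leaves (unlabel t) = m.+1.
  by rewrite -size_labels (perm_size (perm_labels_tree pv)) size_iota.
have cnt : forall v : 'I_m.+1, #|rectree_subtree p v| = size (descendants t v.+1).
  move=> v; rewrite cardE -(size_map (fun u : 'I_m.+1 => u.+1)).
  apply/perm_size/uniq_perm.
  - by rewrite map_inj_uniq ?enum_uniq // => i j [/val_inj].
  - exact: uniq_descendants.
  move=> u; apply/mapP/idP => [[w]|ud].
    by rewrite mem_enum unfold_in => ? ->; rewrite -rectree_subtreeE.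
  have := descendants_sub ud; rewrite mE => um.
  have um' : (u.-1 < m.+1)%N by lia.
  exists (Ordinal um'); last by rewrite /=; lia.
  rewrite mem_enum unfold_in; have := @rectree_subtreeE m (Ordinal um') v pv.
  by rewrite /rectree_subtree => -> /=; rewrite prednK //; lia.
rewrite -lt -count_descendants // lt (seq.permP (perm_labels_tree pv)) /rectree_subtrees.
rewrite -sum1_card -sum1_count (iotaDl 1 0) big_map -[iota 0 _]/(index_iota 0 m.+1)
  big_mkord.
by apply: eq_bigl => v; rewrite inE cnt add1n.
Qed.

End recursive_tree.

(** A list [q] of parents starts with the parent of the node 2. *)
Definition parent_of (q : seq nat) (i : nat) := nth 0 q i.-2.

Fixpoint parent_seqs (m : nat) : seq (seq nat) :=
  if m is m'.+1 then [seq rcons q j | q <- parent_seqs m', j <- iota 1 m] else [:: [::]].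

Lemma parent_seqsS m :
  parent_seqs m.+1 = [seq rcons q j | q <- parent_seqs m, j <- iota 1 m.+1].
Proof. by []. Qed.

Lemma size_parent_seqs m : size (parent_seqs m) = m`!.
Proof. by elim: m => // m IH; rewrite parent_seqsS size_allpairs size_iota IH factS mulnC.
  Qed.

Lemma parent_seqsP m q : q \in parent_seqs m ->
  size q = m /\ valid_parents (parent_of q) m.
Proof.
elim: m q => [|m IH] q; first by rewrite inE => /eqP ->; split=> // i; lia.
rewrite parent_seqsS => /allpairsP[[q' j] [/IH[sq vq] + ->]];
  rewrite mem_iota /= in sq vq * => jm.
rewrite size_rcons sq; split=> // i im; rewrite /parent_of nth_rcons sq.
case: (ltngtP i.-2 m) => [h|h|h]; [|lia|].
  by apply: (vq i); lia.
by lia.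
Qed.

Lemma uniq_parent_seqs m : uniq (parent_seqs m).
Proof.
elim: m => // m IH; rewrite parent_seqsS; apply: allpairs_uniq => //;
  first exact: iota_uniq.
by move=> [q j] [q' j'] _ _ /= /rcons_inj[-> ->].
Qed.

Theorem sum_parent_seqs (V : nmodType) m (F : btree -> V) :
  (\sum_(q <- parent_seqs m) F (unlabel (tree_of_parents (parent_of q) m)) =
  \sum_(t <- shapes m) F t)%R.
Proof.
elim: m F => [|m IH] F; first by rewrite /= !big_seq1.
rewrite [shapes _]/= big_flatten_map -IH parent_seqsS big_allpairs_dep.
apply: eq_big_seq => q /parent_seqsP[sq vq]; have [ul _] := labels_tree vq.
rewrite -(splits_unlabel m.+2 ul) big_map (perm_big _ (perm_labels_tree vq)).
apply: eq_big_seq => j _; congr (F (unlabel _)).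
rewrite /= [parent_of _ m.+2]/parent_of nth_rcons sq ltnn eqxx; congr grow.
apply: eq_tree_of_parents => i im; rewrite /parent_of nth_rcons sq ifT //; lia.
Qed.

End recursive_trees.

(** * The laws of the two subtree counts *)

Section atoms.
Context (R : realType) (d : measure_display) (T : measurableType d).
Variables (P : probability T R) (J : choiceType) (r : seq J) (E : J -> set T) (q : R).
Hypothesis r_uniq : uniq r.
Hypothesis mE : forall j, measurable (E j).
Hypothesis E_disjoint : forall i j, i \in r -> j \in r -> i != j -> E i `&` E j = set0.
Hypothesis PE : forall j, j \in r -> P (E j) = q%:E.
Hypothesis q_total : (size r)%:R * q = 1.

Lemma measure_atoms (s : seq J) : uniq s -> {subset s <= r} ->
  P (\big[setU/set0]_(j <- s) E j) = ((size s)%:R * q)%:E.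
Proof.
elim: s => [|j s IH]; first by rewrite big_nil measure0 mul0r.
move=> /= /andP[js us] sr.
have jr : j \in r by apply: sr; rewrite mem_head.
have sr' : {subset s <= r} by move=> i si; apply: sr; rewrite inE si orbT.
rewrite big_cons measureU //; last 2 first.
- exact: bigsetU_measurable.
- rewrite big_distrr /= big1_seq // => i /= si; apply: E_disjoint => //; first exact: sr'.
  by apply: contraNneq js => ->.
by rewrite -natr1 mulrDl mul1r addrC EFinD -(PE jr) -(IH us sr').
Qed.

Variables (X : T -> nat) (x : J -> nat).
Hypothesis mX : forall l, measurable (X @^-1` [set l]).
Hypothesis XE : forall j w, j \in r -> E j w -> X w = x j.

(** The atoms give lower bounds for the probability of {l} and of its complement
    that add up to 1; outside the atoms [X] is arbitrary. *)
Lemma law_of_atoms l :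
  P (X @^-1` [set l]) = ((count (fun j => x j == l) r)%:R * q)%:E.
Proof.
have lo (a : pred J) (A : set nat) : (forall j, j \in r -> a j -> A (x j)) ->
    (((count a r)%:R * q)%:E <= P (X @^-1` A))%E.
  move=> aA; rewrite -size_filter -measure_atoms ?filter_uniq //; last first.
    by move=> j; rewrite mem_filter => /andP[].
  rewrite le_measure ?inE //; first exact: bigsetU_measurable.
    exact: measurable_preimage_nat.
  rewrite -bigcup_seq => w [j /=]; rewrite mem_filter => /andP[aj jr] Ejw.
  by rewrite /preimage /= (XE jr Ejw); exact: aA.
have Pf : P (X @^-1` [set l]) \is a fin_num by exact: fin_num_measure.
have lo1 := lo (fun j => x j == l) [set l] (fun j _ => elimT eqP).
have := lo (predC (fun j => x j == l)) (~` [set l]) (fun j _ => elimN eqP).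
rewrite -preimage_setC probability_setC // -(fineK Pf) -EFinB lee_fin => lo2.
rewrite -(fineK Pf) lee_fin in lo1.
congr (_%:E); apply/le_anti; rewrite lo1 andbT.
have := q_total; rewrite -(count_predC (fun j => x j == l)) natrD mulrDl; lra.
Qed.

End atoms.

Lemma sum_nat_count (I : Type) (s : seq I) (a : pred I) :
  \sum_(i <- s) (a i : nat) = count a s :> nat.
Proof. by rewrite -sum1_count [RHS]big_mkcond; apply: eq_bigr => i _; case: (a i). Qed.

Section bst_law.
Context (R : realType) (d : measure_display) (T : measurableType d).
Variables (P : probability T R) (n k : nat) (sigma : T -> 'S_n).
Hypothesis k_gt0 : (0 < k)%N.
Hypothesis k_lt_n : (k < n)%N.
Hypothesis sigmaP : uniform_permutation P sigma.

Lemma bst_subtrees_perm (s : 'S_n) :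
  bintree_subtrees k (bst_of_perm s) = fringe_count true k.+1 (bst_shape (bst_of_perm s)).
Proof.
rewrite bintree_subtreesE // [_ == k](_ : _ = false) ?addn0 //.
have ins x t : bintree_size (bst_insert x t) = (bintree_size t).+1.
  by elim: t => //= l IHl y r IHr; case: ifP => _ /=; rewrite ?IHl ?IHr ?addnS ?addSn.
have szf w t : bintree_size (foldl (fun t x => bst_insert x t) t w) =
  (bintree_size t + size w)%N.
  by elim: w t => [|x w IH] t /=; rewrite ?addn0 // IH ins addSnnS.
by rewrite /bst_of_perm szf /= size_map size_enum_ord; lia.
Qed.

Lemma bst_subtrees_measurable l : measurable (bst_subtrees sigma k @^-1` [set l]).
Proof.
have -> : bst_subtrees sigma k @^-1` [set l] = \big[setU/set0]_(s <- enum 'S_n |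
    bintree_subtrees k (bst_of_perm s) == l) (sigma @^-1` [set s]).
  rewrite -bigcup_seq_cond; apply/seteqP; split => [w /= Xw|w [s /= /andP[_ /eqP h] sw]].
    by exists (sigma w) => //=; rewrite mem_enum /=; apply/eqP.
  by rewrite -h -sw.
by apply: bigsetU_measurable => s _; case: (sigmaP s).
Qed.

Lemma bst_subtrees_law l :
  P (bst_subtrees sigma k @^-1` [set l]) = ((fringe_pgf true k.+1 R n)`_l)%:E.
Proof.
have n0 : (n`!%:R : R) != 0 := fact_neq0 R n.
rewrite (@law_of_atoms _ _ _ P _ (enum 'S_n) (fun s => sigma @^-1` [set s]) (n`!%:R^-1)
  _ _ _ _ _ _ (fun s => bintree_subtrees k (bst_of_perm s))).
- rewrite coef_fringe_pgf; congr ((_%:R * _)%:E).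
  rewrite -!sum_nat_count -(sum_bst_of_perm n
    (fun t => fringe_count true k.+1 t == l : nat)) big_enum.
  by apply: eq_bigr => s _; rewrite bst_subtrees_perm.
- exact: enum_uniq.
- by move=> s; case: (sigmaP s).
- by move=> s t _ _ st; apply/seteqP; split=> // w /= [-> ts]; rewrite ts eqxx in st.
- by move=> s _; case: (sigmaP s).
- by rewrite -cardE card_Sn divff.
- exact: bst_subtrees_measurable.
- by move=> s w _ <-.
Qed.

End bst_law.

Lemma eq_rectree_subtrees k n (p p' : nat -> nat) :
  (forall i, (1 < i <= n)%N -> p i = p' i) -> rectree_subtrees k n p =
    rectree_subtrees k n p'.
Proof.
move=> pp; have cE : rectree_child (n := n) p =2 rectree_child p'.
  by move=> u v; rewrite /rectree_child; case: ltnP => //= u1; rewrite pp // u1 ltn_ord.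
apply: eq_card => v; rewrite !inE; congr (_ == _); apply: eq_card => u.
by rewrite !unfold_in; exact: eq_connect.
Qed.

Section rrt_law.
Context (R : realType) (d : measure_display) (T : measurableType d).
Variables (P : probability T R) (m k : nat) (par : nat -> {RV P >-> nat}).
Definition parent_event (q : seq nat) : set T :=
  \bigcap_(i in [set` [fset i in iota 2 m]%fset]) (par i @^-1` [set parent_of q i]).

Lemma parent_eventP q w : parent_event q w <-> forall i, (1 < i <= m.+1)%N -> par i w =
  parent_of q i.
Proof.
split=> [h i im|h i /=]; last by rewrite !inE mem_iota => im; apply: h; lia.
by apply: h; rewrite /= !inE mem_iota; lia.
Qed.

Lemma measurable_parent_event q : measurable (parent_event q).
Proof.
apply: fin_bigcap_measurable; first exact: finite_fset.
by move=> i _; rewrite -[X in measurable X]setTI; exact: measurable_funPT.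
Qed.

Lemma parent_event_disjoint q q' : q \in parent_seqs m -> q' \in parent_seqs m -> q != q' ->
  parent_event q `&` parent_event q' = set0.
Proof.
move=> /parent_seqsP[sq _] /parent_seqsP[sq' _] qq'; apply/seteqP; split=> // w /=.
move=> [/parent_eventP h /parent_eventP h']; move/eqP: qq'; apply.
apply: (@eq_from_nth _ 0%N); rewrite ?sq ?sq' // => i im.
have i2 : (1 < i.+2 <= m.+1)%N by lia.
by have := h _ i2; rewrite h' // /parent_of /=.
Qed.

(** On a null set the parents may take any values, so the event is written as a
    union over all countably many sequences of parents. *)
Lemma rrt_subtrees_measurable l : measurable (rrt_subtrees m.+1 par k @^-1` [set l]).
Proof.
have -> : rrt_subtrees m.+1 par k @^-1` [set l] =
    \bigcup_(q : seq nat) (if rectree_subtrees k m.+1 (parent_of q) == l then parent_event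
      q else set0).
  apply/seteqP; split=> [w /= Xw|w [q _]].
    exists [seq par i w | i <- iota 2 m] => //.
    have pE : forall i, (1 < i <= m.+1)%N -> par i w =
      parent_of [seq par i w | i <- iota 2 m] i.
      move=> i im; rewrite /parent_of (nth_map 0%N) ?size_iota ?nth_iota; try lia.
      by congr (par _ w); lia.
    by rewrite -(eq_rectree_subtrees _ pE) ifT; [exact/parent_eventP|apply/eqP].
  case: eqP => // <- /parent_eventP h; exact: eq_rectree_subtrees.
apply: countable_bigcupT_measurable => // q.
by case: ifP => _ //; exact: measurable_parent_event.
Qed.

Hypothesis k_lt_n : (k < m.+1)%N.
Hypothesis parP : random_recursive_parents m.+1 par.

Lemma prob_parent_event q : q \in parent_seqs m -> P (parent_event q) = (m`!%:R^-1)%:E.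
Proof.
move=> /parent_seqsP[_ vq]; have [pj ind] := parP.
rewrite /parent_event ind //; last by move=> i /=; rewrite !inE mem_iota; lia.
rewrite (perm_big (iota 2 m)) /=; last first.
  by apply: uniq_perm; rewrite ?iota_uniq ?fset_uniq // => i; rewrite !inE.
have prod j : (j <= m)%N ->
    (\prod_(i <- iota 2 j) P (par i @^-1` [set parent_of q i]) = (j`!%:R^-1)%:E)%E.
  elim: j => [|j IH] jm; first by rewrite big_nil fact0 invr1.
  rewrite -[j.+1]addn1 iotaD big_cat big_seq1 /= IH; last exact: ltnW.
  rewrite pj; [|lia|by apply: vq; lia].
  by rewrite -EFinM addn1 factS mulrC natrM invfM.
exact: prod.
Qed.

Lemma rrt_subtrees_law l :
  P (rrt_subtrees m.+1 par k @^-1` [set l]) = ((fringe_pgf false k R m)`_l)%:E.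
Proof.
rewrite (@law_of_atoms _ _ _ P _ (parent_seqs m) parent_event (m`!%:R^-1)
  _ _ _ _ _ _ (fun q => rectree_subtrees k m.+1 (parent_of q))).
- rewrite coef_fringe_pgf; congr ((_%:R * _)%:E).
  rewrite -!sum_nat_count -(sum_parent_seqs m (fun t => fringe_count false k t == l : nat)).
  apply: eq_big_seq => q /parent_seqsP[_ vq].
  by rewrite rectree_subtreesE // [_ == k](_ : _ = false) ?addn0 //; lia.
- exact: uniq_parent_seqs.
- exact: measurable_parent_event.
- exact: parent_event_disjoint.
- exact: prob_parent_event.
- by rewrite size_parent_seqs divff // fact_neq0.
- exact: rrt_subtrees_measurable.
- by move=> q w qm /parent_eventP h; exact: eq_rectree_subtrees.
Qed.

End rrt_law.

Lemma fringe_law (R : realType) : exists2 C : R, 0 <= C &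
  forall (d : measure_display) (T : measurableType d)
    (P : probability T R) (X : T -> nat) (e : bool) (K m : nat),
  (0 < K <= m)%N ->
  (forall l, measurable (X @^-1` [set l])) ->
  (forall l, P (X @^-1` [set l]) = ((fringe_pgf e K R m)`_l)%:E) ->
  [/\ expect_nat P X = ((1 + e%:R) * m.+1%:R / (K%:R * K.+1%:R))%:E,
      dTV_poisson P X = half_l1_poisson P X
    & (dTV_poisson P X <= (C / K%:R)%:E)%E].
Proof.
exists 1655; first exact: ler0n.
move=> d T P X e K m /andP[K0 Km] mX PX; have p1 := fringe_pgf_at1 e K R m.
have b1 : 1 <= 1 + e%:R :> R by rewrite lerDl.
have g0 : 0 <= e%:R :> R by [].
have g1 : e%:R <= 1 :> R by case: (e).
have b2 : 1 + e%:R <= 2 :> R by lra.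
have rec := fringe_recursion e R K0.
have mean := recursion_mean K0 b1 b2 g0 g1 (fringe_pgf0 e K R) (fringe_pgf_at1 e K R) rec
  Km.
have lam0 : 0 < (fringe_pgf e K R m)^`().[1].
  by rewrite mean divr_gt0 ?mulr_gt0 ?ltr0n // (lt_le_trans ltr01 b1).
have dE := dTV_poisson_excess mX PX p1 lam0.
split; first by rewrite (law_expectation mX PX) mean.
- by rewrite dE (half_l1_poisson_excess mX PX p1 lam0).
rewrite dE lee_fin.
exact: (recursion_excess K0 b1 b2 g0 g1 (fringe_pgf0 e K R) (fringe_pgf_at1 e K R)
  (fringe_pgf_ge0 e K R) rec Km).
Qed.

Lemma dTV_poisson_ge0 (R : realType) (d : measure_display) (T : measurableType d)
    (P : probability T R) (X : T -> nat) : (0 <= dTV_poisson P X)%E.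
Proof.
apply: (@le_trans _ _ `|pushforward P X set0
  - poisson_prob (fine (expect_nat P X)) 0 set0|%E) => //.
by apply: ereal_sup_ubound; exists set0.
Qed.

Lemma dTV_poisson_cvg0 (R : realType) (C : R) (k : nat -> nat) (u : nat -> \bar R) :
  (\forall n \near \oo, (1 <= k n < n)%N) -> k @ \oo --> \oo ->
  (forall n, (0 <= u n)%E) ->
  (forall n, (1 <= k n < n)%N -> (u n <= (C / (k n)%:R)%:E)%E) ->
  u @ \oo --> 0%E.
Proof.
move=> kn koo u0 uC.
apply: (@squeeze_cvge _ _ _ _ (cst 0%E) _ (fun n => (C / (k n)%:R)%:E)).
- near=> n; rewrite u0 uC //; near: n; exact: kn.
- exact: cvg_cst.
apply: cvg_EFin; first exact: nearW.
rewrite -[X in _ --> X](mulr0 C); apply: cvgMr.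
apply/gtr0_cvgV0.
  near=> n; rewrite ltr0n; have : (1 <= k n < n)%N by near: n; exact: kn.
  by case/andP.
exact/cvgrnyP.
Unshelve. all: by end_near. Qed.

Local Open Scope ereal_scope.

Theorem theorem1p4 (R : realType) :
  (exists C : R, forall (n k : nat), (1 <= k < n)%N ->
    forall (d : measure_display) (T : measurableType d) (P : probability T R)
      (sigma : T -> 'S_n), uniform_permutation P sigma ->
    let X := bst_subtrees sigma k in
    [/\ expect_nat P X = ((2 * n.+1%:R) / (k.+1%:R * k.+2%:R))%:E,
        dTV_poisson P X = half_l1_poisson P X
      & dTV_poisson P X <= (C / k%:R)%:E])
  /\
  (exists C : R, forall (n k : nat), (1 <= k < n)%N ->
    forall (d : measure_display) (T : measurableType d) (P : probability T R)
      (par : nat -> {RV P >-> nat}), random_recursive_parents n par ->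
    let X := rrt_subtrees n par k in
    [/\ expect_nat P X = (n%:R / (k%:R * k.+1%:R))%:E,
        dTV_poisson P X = half_l1_poisson P X
      & dTV_poisson P X <= (C / k%:R)%:E])
  /\
  (forall (k : nat -> nat), (\forall n \near \oo, (1 <= k n < n)%N) ->
    k @ \oo --> \oo ->
    forall (d : nat -> measure_display) (T : forall n, measurableType (d n))
      (P : forall n, probability (T n) R) (sigma : forall n, T n -> 'S_n),
    (forall n, uniform_permutation (P n) (sigma n)) ->
    dTV_poisson (P n) (bst_subtrees (sigma n) (k n)) @[n --> \oo] --> 0)
  /\
  (forall (k : nat -> nat), (\forall n \near \oo, (1 <= k n < n)%N) ->
    k @ \oo --> \oo ->
    forall (d : nat -> measure_display) (T : forall n, measurableType (d n))
      (P : forall n, probability (T n) R)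
      (par : forall n, nat -> {RV (P n) >-> nat}),
    (forall n, random_recursive_parents n (par n)) ->
    dTV_poisson (P n) (rrt_subtrees n (par n) (k n)) @[n --> \oo] --> 0).
Proof.
have [C C0 law] := fringe_law R.
have bst n k d T P sigma : (1 <= k < n)%N -> @uniform_permutation R d T P n sigma ->
    let X := bst_subtrees sigma k in
    [/\ expect_nat P X = ((2 * n.+1%:R) / (k.+1%:R * k.+2%:R))%:E,
        dTV_poisson P X = half_l1_poisson P X
      & dTV_poisson P X <= (C / k%:R)%:E].
  move=> /andP[k0 kn] sP.
  have [mean half bound] := law d T P (bst_subtrees sigma k) true k.+1 n kn
    (bst_subtrees_measurable k sP) (bst_subtrees_law k0 kn sP).
  split; [by rewrite mean mulr2n | exact: half | apply: (le_trans bound)].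
  rewrite lee_fin ler_wpM2l //.
  by rewrite lef_pV2 ?posrE ?ltr0n // ler_nat.
have rrt n k d T P par : (1 <= k < n)%N -> @random_recursive_parents R d T P n par ->
    let X := rrt_subtrees n par k in
    [/\ expect_nat P X = (n%:R / (k%:R * k.+1%:R))%:E,
        dTV_poisson P X = half_l1_poisson P X
      & dTV_poisson P X <= (C / k%:R)%:E].
  case: n par => [|m] par kn pP; first by lia.
  have km : (k < m.+1)%N by case/andP: kn.
  have [mean half bound] := law d T P (rrt_subtrees m.+1 par k) false k m kn
    (rrt_subtrees_measurable m k par) (rrt_subtrees_law km pP).
  by split; [rewrite mean addr0 mul1r | exact: half | exact: bound].
split; first by exists C => n k kn d T P sigma sP; exact: bst.
split; first by exists C => n k kn d T P par pP; exact: rrt.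
split=> k kn koo d T P f fP; apply: (dTV_poisson_cvg0 (C := C) kn koo).
- by move=> n; exact: dTV_poisson_ge0.
- by move=> n h; have [] := bst n (k n) _ _ _ _ h (fP n).
- by move=> n; exact: dTV_poisson_ge0.
- by move=> n h; have [] := rrt n (k n) _ _ _ _ h (fP n).
Qed.
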